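(* Let $\mathbb{F}$ be a field with $q$ elements ($q$ finite), and let $G=\langle g\rangle$ be a cyclic group (finite or infinite) with $|G|>2$ and identity element $e$. Let $\widetilde{M}=M_2(\mathbb{F})$ with the $G$-grading $$\widetilde{M}_e=\begin{pmatrix}\mathbb{F}&0\\0&\mathbb{F}\end{pmatrix},\quad \widetilde{M}_g=\begin{pmatrix}0&\mathbb{F}\\0&0\end{pmatrix},\quad \widetilde{M}_{g^{-1}}=\begin{pmatrix}0&0\\ \mathbb{F}&0\end{pmatrix},\quad \widetilde{M}_h=0\ \text{ for } h\in G\setminus\{e,g,g^{-1}\}.$$ Then the ideal of $G$-graded polynomial identities of $\widetilde{M}$ is generated, as a $T_G$-ideal, by the polynomials $$f_1=y_1^{q}-y_1,$$ $$f_2=(X_1-X_1^{q})(X_2-X_2^{q^2})(1-[X_1,X_2]^{q-1}),\quad X_i=y_i+z_i+w_i\ (i=1,2),$$ $$f_3=z_1z_2,\qquad f_4=w_1w_2,$$ $$x_{1,h},\quad h\in G\setminus\{e,g,g^{-1}\},$$ where $y_i$, $z_i$, $w_i$ are indeterminates of degree $e$, $g$, $g^{-1}$, respectively.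
   Context: Algebras are associative and not necessarily unital. For a group $G$, a $G$-graded $\mathbb{F}$-algebra is an algebra $A=\bigoplus_{g\in G}A_g$ (direct sum of subspaces) with $A_gA_h\subseteq A_{gh}$. $\mathbb{F}\langle X_G\rangle$ is the free $G$-graded associative algebra (without unit) on the disjoint union of the countable sets $X_g=\{x_{i,g}\mid i\ge 1\}$, $g\in G$, where $x_{i,g}$ has degree $g$. A polynomial $f(x_{1,g_1},\dots,x_{n,g_n})$ is a graded polynomial identity of $A$ if $f(a_1,\dots,a_n)=0$ for all $a_i\in A_{g_i}$. The set $Id_G(A)$ of graded identities of $A$ is a $T_G$-ideal, i.e. a two-sided ideal invariant under all graded endomorphisms of $\mathbb{F}\langle X_G\rangle$. The $T_G$-ideal generated by a set $S$ is the smallest $T_G$-ideal containing $S$. Here $y_i=x_{i,e}$, $z_i=x_{i,g}$, $w_i=x_{i,g^{-1}}$, and $[a,b]=ab-ba$. The expression $u(1-v)$ means $u-uv$. *)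

(* Defs.v *)
From mathcomp Require Import all_boot all_order all_algebra.
From mathcomp Require Import finmap monalg.

Set Implicit Arguments.
Unset Strict Implicit.
Unset Printing Implicit Defensive.

Import GRing.Theory.
Local Open Scope ring_scope.

Section FreeGradedAlgebra.
Variables (F : fieldType) (G : groupType).

(* The unital free algebra on the variables (i, h), where (i, h) stands for
   x_{i+1,h}. The free algebra without unit is its subset [nonunital], the
   polynomials with no constant term. *)
Local Notation gvar := (nat * G)%type.

Definition freealg := {malg F[{fmonom gvar}]}.

Definition xvar (i : nat) (h : G) : freealg := << fmu ((i, h) : gvar) >>.

Definition nonunital : {pred freealg} :=
  [pred p : freealg | p@_(mone : {fmonom gvar}) == 0].

Definition word_deg (m : {fmonom gvar}) : G :=
  (\prod_(v <- (m : seq gvar)) v.2)%g.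

Definition free_comp (h : G) (p : freealg) : Prop :=
  p \in nonunital /\ {in msupp p, forall m, word_deg m = h}.

(* Only the restriction of [phi] to [nonunital] matters. *)
Record graded_endo (phi : freealg -> freealg) : Prop := GradedEndo {
  endo_linear : forall (c : F) (p r : freealg),
    p \in nonunital -> r \in nonunital ->
    phi (c *: p + r) = c *: phi p + phi r;
  endo_mul : forall p r : freealg,
    p \in nonunital -> r \in nonunital -> phi (p * r) = phi p * phi r;
  endo_graded : forall (h : G) (p : freealg),
    free_comp h p -> free_comp h (phi p)
}.

Record TG_ideal (I : freealg -> Prop) : Prop := TGIdeal {
  TG_sub : forall p, I p -> p \in nonunital;
  TG_0 : I 0;
  TG_linear : forall (c : F) (p r : freealg), I p -> I r -> I (c *: p + r);
  TG_mull : forall p r : freealg, p \in nonunital -> I r -> I (p * r);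
  TG_mulr : forall p r : freealg, I p -> r \in nonunital -> I (p * r);
  TG_endo : forall (phi : freealg -> freealg) (p : freealg),
    graded_endo phi -> I p -> I (phi p)
}.

Definition TG_generated (S : freealg -> Prop) (p : freealg) : Prop :=
  forall I, TG_ideal I -> (forall s, S s -> I s) -> I p.

Definition free_eval (A : algType F) (a : nat -> G -> A) (p : freealg) : A :=
  \sum_(m <- msupp p) p@_m *: \prod_(v <- (m : seq gvar)) a v.1 v.2.

Definition graded_identity (A : algType F) (Agr : G -> {pred A})
    (p : freealg) : Prop :=
  p \in nonunital /\
  forall a : nat -> G -> A, (forall i h, a i h \in Agr h) ->
    free_eval a p = 0.

End FreeGradedAlgebra.

Definition cyclic_generator (G : groupType) (g : G) : Prop :=
  forall h : G, exists n : nat, h = (g ^+ n)%g \/ h = (g ^- n)%g.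

(* |T| > n, for a possibly infinite T. *)
Definition card_gt (T : eqType) (n : nat) : Prop :=
  exists s : seq T, uniq s /\ (n < size s)%N.

(* For a generator [g] of a group with more than two elements, the elements
   1, g, g^-1 are distinct. *)
Definition M2_comp (F : fieldType) (G : groupType) (g h : G) :
    {pred 'M[F]_2} := [pred A : 'M[F]_2 |
  if h == 1%g then (A 0 1 == 0) && (A 1 0 == 0)
  else if h == g then [&& A 0 0 == 0, A 1 0 == 0 & A 1 1 == 0]
  else if h == g^-1%g then [&& A 0 0 == 0, A 0 1 == 0 & A 1 1 == 0]
  else A == 0].

Section Generators.
Variables (F : fieldType) (G : groupType) (g : G) (q : nat).

(* The index is shifted by one, as in [xvar]: [yvar 0] is y_1. *)
Definition yvar (i : nat) : freealg F G := xvar F i 1%g.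
Definition zvar (i : nat) : freealg F G := xvar F i g.
Definition wvar (i : nat) : freealg F G := xvar F i g^-1%g.
Definition Xvar (i : nat) : freealg F G := yvar i + zvar i + wvar i.

Definition lie (a b : freealg F G) : freealg F G := a * b - b * a.

Definition f1 : freealg F G := yvar 0 ^+ q - yvar 0.

Definition f2 : freealg F G :=
  let u := (Xvar 0 - Xvar 0 ^+ q) * (Xvar 1 - Xvar 1 ^+ (q ^ 2)) in
  u - u * lie (Xvar 0) (Xvar 1) ^+ (q - 1).

Definition f3 : freealg F G := zvar 0 * zvar 1.

Definition f4 : freealg F G := wvar 0 * wvar 1.

Definition generators (p : freealg F G) : Prop :=
  p = f1 \/ p = f2 \/ p = f3 \/ p = f4 \/
  exists h : G, [/\ h != 1%g, h != g, h != g^-1%g & p = xvar F 0 h].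

End Generators.

(* Main.v *)
Require Import Defs.
From mathcomp Require Import all_boot all_order all_algebra.
From mathcomp Require Import finmap monalg.
From HB Require Import structures.
From mathcomp Require Import all_field ring.
From mathcomp Require boolp classical_sets.

(* Let I be a T_G-ideal containing the generators and let E, Z, W be the
   components of degree 1, g, g^-1 of the free algebra. Every a in E satisfies
   a^q = a modulo I; as X^q - X splits over F, the Lagrange polynomials of a
   are idempotents with sum 1, and E is commutative modulo I. Let p in Z be an
   identity not in I, and take a sub-bimodule N of Z over E, containing the
   intersection of Z and I and maximal among those avoiding p. The idempotents
   show that E acts on Z / N on the left and on the right by characters chi1
   and chi2, so by maximality Z = N + F p. Writing z = s(z) p modulo N and
   evaluating z w z' in two ways, one gets
   chi1(z w) = s(z) r(w) and chi2(w z) = r(w) s(z) with r(w) = chi2(w p), i.e.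
   (chi1, s; r, chi2) is a graded homomorphism to M_2(F) sending p to a nonzero
   matrix: a contradiction. Degree g^-1 is symmetric. An identity p of degree 1
   has p Z and Z p inside I, so a character of E that does not kill p kills
   Z W and W Z, and the scalar matrices it defines contradict the identity.
   For f2: a 2x2 matrix B with B^(q^2) <> B has the form l + N with N^2 = 0, so
   that B - B^(q^2) = N, and N A N = tr(A N) N for all A. *)

Set Implicit Arguments.
Unset Strict Implicit.
Unset Printing Implicit Defensive.

Import GRing.Theory.
Local Open Scope ring_scope.

(** * Algebras satisfying a^q = a modulo an ideal *)

Section Subspaces.
Variables (F : fieldType) (V : lmodType F).

Definition subspace (U : V -> Prop) : Prop :=
  U 0 /\ forall (c : F) u v, U u -> U v -> U (c *: u + v).

Variables (U : V -> Prop) (subU : subspace U).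

Lemma subspaceD u v : U u -> U v -> U (u + v).
Proof. by move=> Uu Uv; rewrite -[u]scale1r; apply: subU.2. Qed.

Lemma subspaceZ c u : U u -> U (c *: u).
Proof. by move=> Uu; rewrite -[_ *: _]addr0; apply: subU.2 => //;
  apply: subU.1. Qed.

Lemma subspaceB u v : U u -> U v -> U (u - v).
Proof. by move=> Uu Uv; apply: subspaceD => //; rewrite -scaleN1r;
  apply: subspaceZ. Qed.

Lemma subspace_sum (J : Type) (r : seq J) (P : pred J) (f : J -> V) :
  (forall j, P j -> U (f j)) -> U (\sum_(j <- r | P j) f j).
Proof. by move=> Uf; elim/big_ind: _ => //;
  [apply: subU.1 | apply: subspaceD]. Qed.

Lemma subspaceBl u v : U (u - v) -> U v -> U u.
Proof. by move=> Uuv Uv; rewrite -[u](subrK v); apply: subspaceD. Qed.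

Lemma subspaceBr u v : U (u - v) -> U u -> U v.
Proof. by move=> Uuv Uu; rewrite -[v](subKr u); apply: subspaceB. Qed.

Lemma subspaceDr u v : U (u + v) -> U u -> U v.
Proof. by move=> Uuv Uu; rewrite -[v](addKr u) addrC; apply: subspaceB. Qed.

End Subspaces.

Section Subalgebras.
Variables (F : fieldType) (S : algType F).

Definition two_sided_ideal (I : S -> Prop) : Prop :=
  [/\ subspace I, forall a u, I u -> I (a * u) & forall a u, I u -> I (u * a)].

Definition subalgebra (E : S -> Prop) : Prop :=
  [/\ subspace E, E 1 & forall a b, E a -> E b -> E (a * b)].

End Subalgebras.

(** * Idempotents and commutativity when a^q = a modulo an ideal *)

Section PowerIdentity.
Variables (F : finFieldType) (S : algType F).

(* The value at [a] is the idempotent onto the eigenspace of [a] for [c]. *)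
Definition eigen_idem (c : F) : {poly F} := 1 - ('X - c%:P) ^+ #|F|.-1.

Lemma eigen_idem_eval (c d : F) : (eigen_idem c).[d] = (d == c)%:R.
Proof.
rewrite /eigen_idem !hornerE; have [->|dc] := eqVneq d c.
  by rewrite subrr expr0n -leqn0 leqNgt -ltnS prednK ?finNzRing_gt1 ?subr0 //
    ltnW ?finNzRing_gt1.
apply/eqP; rewrite subr_eq0 eq_sym; apply/eqP.
have nz: d - c != 0 by rewrite subr_eq0.
apply: (mulfI nz); rewrite mulr1 -exprS prednK ?expf_card //.
by rewrite ltnW ?finNzRing_gt1.
Qed.

Variable I : S -> Prop.
Hypothesis idealI : two_sided_ideal I.

Let subI : subspace I. Proof. by case: idealI. Qed.
Let Il a u : I u -> I (a * u). Proof. by case: idealI => _ + _; apply. Qed.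
Let Ir a u : I u -> I (u * a). Proof. by case: idealI => _ _; apply. Qed.

(** X^q - X is the product of all X - c with c in F, so it divides every polynomial that vanishes on
    F; its value at [a] lies in [I]. *)
Lemma vanishing_horner_alg (a : S) (P : {poly F}) :
  I (a ^+ #|F| - a) -> (forall c, P.[c] = 0) -> I (horner_alg a P).
Proof.
move=> Ia P0; have : 'X^#|F| - 'X %| P.
  rewrite finField_genPoly -big_enum /=; apply: uniq_roots_dvdp.
    by apply/allP => c _; apply/rootP.
  by rewrite uniq_rootsE enum_uniq.
case/dvdpP => Q ->; rewrite rmorphM rmorphB rmorphXn /= horner_algX.
exact: Il.
Qed.

(** Substitution in f_1 only reaches polynomials without constant term; this adds the constants. The
    polynomial (c + X)^q - (c + X) vanishes on F. *)
Lemma power_add_scalar (r : S) (c : F) : I (r ^+ #|F| - r) ->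
  I ((c%:A + r) ^+ #|F| - (c%:A + r)).
Proof.
move=> Ipow; have -> : (c%:A + r) ^+ #|F| - (c%:A + r) =
    horner_alg r ((c%:P + 'X) ^+ #|F| - (c%:P + 'X)).
  by rewrite rmorphB rmorphXn rmorphD /= horner_algX horner_algC.
apply: vanishing_horner_alg => // d.
by rewrite !hornerE expf_card subrr.
Qed.

Variable E : S -> Prop.
Hypothesis subalgE : subalgebra E.
Hypothesis E_power : forall a, E a -> I (a ^+ #|F| - a).

Let subE : subspace E. Proof. by case: subalgE. Qed.
Let E1 : E 1. Proof. by case: subalgE. Qed.
Let EM a b : E a -> E b -> E (a * b). Proof. by case: subalgE => _ _;
  apply. Qed.

Lemma subalgebra_scalar c : E c%:A.
Proof. exact: subspaceZ. Qed.

Lemma subalgebra_horner a P : E a -> E (horner_alg a P).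
Proof.
move=> Ea; elim/poly_ind: P => [|P c IH]; first by rewrite rmorph0;
  apply: subE.1.
rewrite rmorphD rmorphM /= horner_algX horner_algC.
by apply: subspaceD => //; [apply: EM | apply: subspaceZ].
Qed.

Lemma eigen_idemP a c : E a -> I ((a - c%:A) * horner_alg a (eigen_idem c)).
Proof.
move=> Ea; have -> : a - c%:A = horner_alg a ('X - c%:P).
  by rewrite rmorphB /= horner_algX horner_algC.
rewrite -rmorphM; apply: vanishing_horner_alg => [|d]; first exact: E_power.
rewrite hornerM eigen_idem_eval !hornerE.
by have [->|] := eqVneq d c; rewrite ?subrr ?mul0r ?mulr0.
Qed.

Lemma eigen_idemPr a c : E a -> I (horner_alg a (eigen_idem c) * (a - c%:A)).
Proof.
move=> Ea; suff -> : horner_alg a (eigen_idem c) * (a - c%:A)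
    = (a - c%:A) * horner_alg a (eigen_idem c) by apply: eigen_idemP.
have -> : a - c%:A = horner_alg a ('X - c%:P).
  by rewrite rmorphB /= horner_algX horner_algC.
by rewrite -!rmorphM mulrC.
Qed.

Lemma sum_eigen_idem a : E a -> I (1 - \sum_c horner_alg a (eigen_idem c)).
Proof.
move=> Ea; rewrite -(rmorph1 (horner_alg a)) -rmorph_sum -rmorphB.
apply: vanishing_horner_alg => [|d]; first exact: E_power.
rewrite hornerD hornerN horner_sum hornerC (bigD1 d) //= big1 ?addr0.
  by rewrite eigen_idem_eval eqxx subrr.
by move=> c cd; rewrite eigen_idem_eval eq_sym (negbTE cd).
Qed.

(** Modulo [I], t equals t^q, which is a multiple of t^2 because q >= 2. *)
Lemma reduced_mod_ideal t : E t -> I (t * t) -> I t.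
Proof.
move=> Et Itt; apply: (subspaceBr subI (E_power Et)).
have /subnK <- : (2 <= #|F|)%N by apply: finNzRing_gt1.
by rewrite exprD expr2; apply: Il.
Qed.

(* Jacobson's theorem; it is elementary here because F splits X^q - X. *)
Lemma comm_mod_ideal a x : E a -> E x -> I (a * x - x * a).
Proof.
move=> Ea Ex; pose L c := horner_alg a (eigen_idem c).
(* The square of this element has the inner factor L_c (a - c), which lies in [I]. *)
have IL c : I ((a - c%:A) * x * L c).
  apply: reduced_mod_ideal.
    do 2?[apply: EM => //]; last exact: subalgebra_horner.
    by apply: subspaceB => //; apply: subalgebra_scalar.
  rewrite mulrA; apply: Ir; rewrite -!mulrA; apply: Il; apply: Il.
  by rewrite mulrA; apply: Ir; apply: eigen_idemPr.
(* As the L_c sum to 1 modulo [I], it suffices to treat [a, x] L_c, which is a difference of two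
   elements of [I]. *)
rewrite -[_ - _]mulr1 -[1](subrK (\sum_c L c)) mulrDr.
apply: subspaceD => //; first by apply: Il; apply: sum_eigen_idem.
rewrite mulr_sumr; apply: subspace_sum => // c _.
have -> : (a * x - x * a) * L c =
    (a - c%:A) * x * L c - x * ((a - c%:A) * L c).
  rewrite !(mulrBl, mulrBr) !mulrA -!scalerAl -!scalerAr -!scalerAl mulr1 mul1r.
  by rewrite opprB addrA addrNK.
apply: subspaceB => //; apply: Il; exact: eigen_idemP.
Qed.

Definition subbimodule (M : S -> Prop) : Prop :=
  [/\ subspace M, forall a u, E a -> M u -> M (a * u)
    & forall a u, E a -> M u -> M (u * a)].

(** * Characters of E acting on a bimodule *)

Section Characters.
Variables (M : S -> Prop) (p : S).
Hypothesis subM : subbimodule M.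
Hypothesis Mp : M p.
Hypothesis nIp : ~ I p.

Let sM : subspace M. Proof. by case: subM. Qed.
Let Ml a u : E a -> M u -> M (a * u). Proof. by case: subM => _ + _; apply. Qed.
Let Mr a u : E a -> M u -> M (u * a). Proof. by case: subM => _ _; apply. Qed.

Definition avoids (N : S -> Prop) : Prop :=
  [/\ subbimodule N, forall u, N u -> M u, forall u, M u -> I u -> N u & ~ N p].

Lemma maximal_avoids : exists N, avoids N /\
  forall N', avoids N' -> (forall u, N u -> N' u) -> forall u, N' u -> N u.
Proof.
pose P N := (forall u, ~ N u) \/ avoids N.
have base : avoids (fun u => M u /\ I u).
  split=> [||//|[]//]; last by move=> u [].
  split.
  - split; first by split; [apply: sM.1 | apply: subI.1].
    by move=> c u v [? ?] [? ?]; split; [apply: sM.2 | apply: subI.2].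
  - by move=> a u Ea [? ?]; split; [apply: Ml | apply: Il].
  - by move=> a u Ea [? ?]; split; [apply: Mr | apply: Ir].
have [|N [PN maxN]] := @classical_sets.Zorn_bigcup S P.
  move=> C CP tot; rewrite /classical_sets.bigcup /classical_sets.mkset /=.
  have [[N0 [CN0 [u0 Nu0]]]|none] := boolp.EM (exists N, C N /\ exists u, N u);
    last first.
    by left => u [N CN Nu]; apply: none; exists N; split=> //; exists u.
  have good N u : C N -> N u -> avoids N by move=> /CP[/(_ u)//|].
  have both N1 u N2 v : C N1 -> C N2 -> N1 u -> N2 v ->
      exists N, [/\ C N, avoids N, N u & N v].
    move=> C1 C2 Nu Nv; case: (tot _ _ C1 C2) => le.
      by exists N2; split=> //; [apply: (good _ v) | apply: le].
    by exists N1; split=> //; [apply: (good _ u) | apply: le].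
  right; split.
  - split.
    + split; first by exists N0 => //; case: (good _ _ CN0 Nu0) => -[[]].
      move=> c u v [N1 C1 N1u] [N2 C2 N2v].
      have [N [CN [[[_ Nlin] _ _] _ _ _] Nu Nv]] := both _ _ _ _ C1 C2 N1u N2v.
      by exists N => //; apply: Nlin.
    + move=> a u Ea [N CN Nu]; exists N => //.
      by have [[_ + _] _ _ _] := good _ _ CN Nu; apply.
    + move=> a u Ea [N CN Nu]; exists N => //.
      by have [[_ _ +] _ _ _] := good _ _ CN Nu; apply.
  - by move=> u [N CN Nu]; have [_ + _ _] := good _ _ CN Nu; apply.
  - move=> u Mu Iu; exists N0 => //.
    by have [_ _ + _] := good _ _ CN0 Nu0; apply.
  - by move=> [N CN Np]; have [_ _ _] := good _ _ CN Np.
have max' N' : avoids N' -> (forall u, N u -> N' u) -> forall u, N' u -> N u.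
  move=> gN' le u N'u; apply: boolp.contrapT => nNu.
  by apply: (maxN N'); [split=> // /(_ u N'u) | right].
exists N; split=> //; case: PN => // empty.
(* An empty N would lie below the intersection of M and I, which contains 0, against maximality. *)
exfalso; apply: (empty 0); apply: (max' _ base) => [u /empty//|].
by split; [apply: sM.1 | apply: subI.1].
Qed.

(* Modulo a maximal subbimodule avoiding [p], M becomes one-dimensional. *)
Lemma bimodule_character : exists chi1 chi2 s : S -> F,
  [/\ forall a u, E a -> M u -> s (a * u) = chi1 a * s u,
      forall a u, E a -> M u -> s (u * a) = s u * chi2 a,
      forall c u v, M u -> M v -> s (c *: u + v) = c * s u + s v,
      forall u, M u -> I u -> s u = 0
    & s p = 1].
Proof.
have [N [[[sN Nl Nr] NM IN nNp] maxN]] := maximal_avoids.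
(* By maximality, left multiplication by [a] and right multiplication by [b] act as scalars on M /
   N. *)
have scalars a b : E a -> E b -> exists c d, forall u, M u ->
    N ((a - c%:A) * u) /\ N (u * (b - d%:A)).
  move=> Ea Eb.
  pose L c := horner_alg a (eigen_idem c);
    pose R d := horner_alg b (eigen_idem d).
  have EL c : E (L c) by apply: subalgebra_horner.
  have ER c : E (R c) by apply: subalgebra_horner.
  (* Modulo [I], p is the sum of the L_c p R_d, so some summand lies outside N. *)
  have [c [d nNcd]] : exists c d, ~ N (L c * p * R d).
    apply: boolp.contrapT => noncd; apply: nNp.
    have Nsum : N ((\sum_c L c) * p * (\sum_d R d)).
      rewrite mulr_suml mulr_suml; apply: subspace_sum => // c _.
      rewrite mulr_sumr; apply: subspace_sum => // d _.
      by apply: boolp.contrapT => h; apply: noncd; exists c, d.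
    apply: (subspaceBl sN _ Nsum); apply: IN.
      apply: subspaceB => //; apply: Mr; last apply: Ml => //;
      by apply: subspace_sum.
    have -> : p - (\sum_c L c) * p * (\sum_d R d) =
      (1 - \sum_c L c) * p + (\sum_c L c) * p * (1 - \sum_d R d).
      by rewrite mulrBl mul1r mulrBr mulr1 addrA addrNK.
    apply: subspaceD => //; first by apply: Ir; apply: sum_eigen_idem.
    by apply: Il; apply: sum_eigen_idem.
  exists c, d.
  (* N' contains N and misses p. It is a sub-bimodule because E is commutative modulo [I], so N' =
     N; and (a - c) u and u (b - d) lie in N'. *)
  pose N' u := M u /\ N (L c * u * R d).
  have sub u : N' u -> N u.
    apply: maxN; last by move=> v Nv; split; [apply: NM | apply: Nr => //;
      apply: Nl].
    split; [split | by move=> v [] | | by move=> []].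
    - split; first by split; [apply: sM.1 | rewrite mulr0 mul0r; apply: sN.1].
      move=> k v w [Mv Nv] [Mw Nw]; split; first exact: sM.2.
      by rewrite mulrDr mulrDl -scalerAr -scalerAl; apply: sN.2.
    - move=> e v Ee [Mv Nv]; split; first exact: Ml.
      have NeL : N (e * (L c * v * R d)) by apply: Nl.
      apply: (subspaceBl sN _ NeL); apply: IN.
        apply: subspaceB => //; first by apply: Mr => //; apply: Ml => //;
          apply: Ml.
        by apply: Ml => //; apply: Mr => //; apply: Ml.
      rewrite !mulrA -!mulrBl; apply: Ir; apply: Ir; exact: comm_mod_ideal.
    - move=> e v Ee [Mv Nv]; split; first exact: Mr.
      have NeL : N (L c * v * R d * e) by apply: Nr.
      apply: (subspaceBl sN _ NeL); apply: IN.
        apply: subspaceB => //; first by apply: Mr => //; apply: Ml => //;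
          apply: Mr.
        by apply: Mr => //; apply: Mr => //; apply: Ml.
      rewrite -!mulrA -!mulrBr; apply: Il; apply: Il; exact: comm_mod_ideal.
    - move=> v Mv Iv; split=> //; apply: IN; first by apply: Mr => //;
      apply: Ml.
      by apply: Ir; apply: Il.
  have Eac : E (a - c%:A) by apply: subspaceB => //; apply: subalgebra_scalar.
  have Ebd : E (b - d%:A) by apply: subspaceB => //; apply: subalgebra_scalar.
  move=> u Mu; split; apply: sub.
  - split; first exact: Ml.
    apply: IN; first by apply: Mr => //; do 2?apply: Ml.
    by rewrite mulrA; do 2!apply: Ir; apply: eigen_idemPr.
  - split; first exact: Mr.
    apply: IN; first by apply: Mr => //; apply: Ml => //; apply: Mr.
    by rewrite -!mulrA; do 2!apply: Il; apply: eigen_idemP.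
have /boolp.choice[chi1 chi1P] a :
    exists c, E a -> forall u, M u -> N (a * u - c *: u).
  have [Ea|nEa] := boolp.EM (E a); last by exists 0.
  have [c [d h]] := scalars a a Ea Ea; exists c => _ u /h[+ _].
  by rewrite mulrBl -scalerAl mul1r.
have /boolp.choice[chi2 chi2P] a :
    exists c, E a -> forall u, M u -> N (u * a - c *: u).
  have [Ea|nEa] := boolp.EM (E a); last by exists 0.
  have [d [c h]] := scalars a a Ea Ea; exists c => _ u /h[_].
  by rewrite mulrBr -scalerAr mulr1.
have Np0 c : N (c *: p) -> c = 0.
  move=> Ncp; apply/eqP/negPn/negP => c0; apply: nNp.
  by rewrite -[p](scalerK c0); apply: subspaceZ.
have /boolp.choice[s sP] z : exists c, M z -> N (z - c *: p).
  have [Mz|nMz] := boolp.EM (M z); last by exists 0.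
  have [Nz|nNz] := boolp.EM (N z); first by exists 0 => _;
    rewrite scale0r subr0.
  (* This is N + F z. It must contain p, since otherwise maximality would put z in N. *)
  pose N' u := M u /\ exists c, N (u - c *: z).
  have [[_ [c Nc]]|nN'p] := boolp.EM (N' p).
    have c0 : c != 0 by apply/eqP => c0; apply: nNp;
      rewrite c0 scale0r subr0 in Nc.
    exists c^-1 => _; have := subspaceZ sN (- c^-1) Nc.
    by rewrite scalerBr scalerA mulNr mulVf // scaleNr scaleN1r opprK addrC.
  exfalso; apply: nNz; apply: (maxN N').
  - split=> [|u []//|u Mu Iu|//]; last first.
      by split=> //; exists 0; rewrite scale0r subr0; apply: IN.
    split.
    + split; first by split; [apply: sM.1 | exists 0; rewrite scale0r subr0;
      apply: sN.1].
      move=> k u v [Mu [c Nu]] [Mv [d Nv]]; split; first exact: sM.2.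
      exists (k * c + d); have := sN.2 k _ _ Nu Nv.
      by rewrite scalerBr scalerA scalerDl opprD addrACA.
    + move=> a u Ea [Mu [c Nu]]; split; first exact: Ml.
      exists (c * chi1 a); have := sN.2 c _ _ (chi1P a Ea z Mz) (Nl a _ Ea Nu).
      by rewrite scalerBr scalerA mulrBr -scalerAr addrC addrA addrNK.
    + move=> a u Ea [Mu [c Nu]]; split; first exact: Mr.
      exists (c * chi2 a); have := sN.2 c _ _ (chi2P a Ea z Mz) (Nr a _ Ea Nu).
      by rewrite scalerBr scalerA mulrBl -scalerAl addrC addrA addrNK.
  - by move=> u Nu; split; [apply: NM | exists 0; rewrite scale0r subr0].
  - by split=> //; exists 1; rewrite scale1r subrr; apply: sN.1.
(* No nonzero multiple of p lies in N, so the coefficient of p is unique; each claim on [s] then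
   follows by exhibiting it. *)
have s_uniq z c : M z -> N (z - c *: p) -> s z = c.
  move=> Mz Nc; apply/eqP; rewrite eq_sym -subr_eq0; apply/eqP/Np0.
  have := subspaceB sN (sP z Mz) Nc.
  by rewrite opprB addrC addrA addrNK scalerBl.
exists chi1, chi2, s; split.
- move=> a u Ea Mu; apply: s_uniq; first exact: Ml.
  have := sN.2 (chi1 a) _ _ (sP u Mu) (chi1P a Ea u Mu).
  by rewrite scalerBr scalerA addrC addrA addrNK.
- move=> a u Ea Mu; apply: s_uniq; first exact: Mr.
  have := sN.2 (chi2 a) _ _ (sP u Mu) (chi2P a Ea u Mu).
  by rewrite scalerBr scalerA addrC addrA addrNK mulrC.
- move=> c u v Mu Mv; apply: s_uniq; first exact: sM.2.
  have := sN.2 c _ _ (sP u Mu) (sP v Mv).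
  by rewrite scalerBr scalerA scalerDl opprD addrACA.
- by move=> u Mu Iu; apply: s_uniq => //; rewrite scale0r subr0; apply: IN.
- by apply: s_uniq => //; rewrite scale1r subrr; apply: sN.1.
Qed.

End Characters.
End PowerIdentity.

(** * The free algebra *)

(** Centrality of scalars makes the free algebra an [algType]. The support of c r can be smaller
    than that of r, so both sums are taken over the latter. *)
Lemma malg_scalerAr (R : comNzRingType) (K : monomType) (c : R) (p r : {malg
  R[K]}) :
  c *: (p * r) = p * (c *: r).
Proof.
apply/malgP => k; rewrite mcoeffZ (mcoeffMl p r k).
rewrite (mcoeffMlw k (fsubset_refl (msupp p)) (msuppZ_le c r)) mulr_sumr.
apply: eq_bigr => k1 _; rewrite mulr_sumr; apply: eq_bigr => k2 _.
by rewrite mcoeffZ mulrnAr mulrCA.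
Qed.

Lemma malg_scale_monom (R : nzRingType) (K : choiceType) (c : R) (m : K) :
  c *: (<< m >> : {malg R[K]}) = << c *g m >>.
Proof. by apply/malgP => k; rewrite mcoeffZ !mcoeffU mulrnAr mulr1. Qed.

Lemma subspace_mulr (F : fieldType) (S : algType F) (U : S -> Prop) (r : S) :
  subspace U -> subspace (fun p => U (p * r)).
Proof.
move=> [U0 Ulin]; split=> [|c u v Uu Uv]; first by rewrite mul0r.
by rewrite mulrDl -scalerAl; apply: Ulin.
Qed.

Lemma subspace_mull (F : fieldType) (S : algType F) (U : S -> Prop) (r : S) :
  subspace U -> subspace (fun p => U (r * p)).
Proof.
move=> [U0 Ulin]; split=> [|c u v Uu Uv]; first by rewrite mulr0.
by rewrite mulrDr -scalerAr; apply: Ulin.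
Qed.

Section FreeAlgebra.
Variables (F : fieldType) (G : groupType).
Local Notation gvar := (nat * G)%type.

HB.instance Definition _ := GRing.Lalgebra.on (freealg F G).

HB.instance Definition _ :=
  GRing.Lalgebra_isAlgebra.Build F (freealg F G) (@malg_scalerAr F _).

Definition word (s : seq gvar) : freealg F G := \prod_(v <- s) xvar F v.1 v.2.

Lemma monom_word (m : {fmonom gvar}) : (<< m >> : freealg F G) = word m.
Proof.
case: m => s /=; elim: s => [|v s IH]; rewrite /word ?big_nil ?big_cons.
  by rewrite -fmoneE.
rewrite -/(word s) -IH /xvar -surjective_pairing [RHS]fgmulUU mulr1.
by congr (<< _ *g _ >>); apply/eqP; rewrite fmP fmM fmU.
Qed.

Lemma freealgE (p : freealg F G) :
  p = \sum_(m <- msupp p) p@_m *: word (m : {fmonom gvar}).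
Proof.
rewrite {1}(monalgE p); apply: eq_bigr => m _.
by rewrite -monom_word; apply/esym/malg_scale_monom.
Qed.

Lemma const_word (s : seq gvar) :
  (word s)@_(mone : {fmonom gvar}) = (nilp s)%:R.
Proof.
have := monom_word (FMonom s) => /= <-.
by rewrite mcoeffU1 fmP fm1; case: s.
Qed.

Lemma nonunital_subspace : subspace (fun p => p \in @nonunital F G).
Proof.
split=> [|c u v]; rewrite !inE ?mcoeff0 ?eqxx // mcoeffD mcoeffZ.
by move=> /eqP-> /eqP->; rewrite mulr0 addr0.
Qed.

Lemma const1gM (p r : freealg F G) :
  (p * r)@_(mone : {fmonom gvar}) = p@_mone * r@_mone.
Proof. exact: (mcoeff1g_is_multiplicative {fmonom gvar} F).1. Qed.

Lemma nonunitalMl (p r : freealg F G) :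
  r \in @nonunital F G -> p * r \in @nonunital F G.
Proof. by rewrite !inE const1gM => /eqP->; rewrite mulr0. Qed.

Lemma nonunitalMr (p r : freealg F G) :
  p \in @nonunital F G -> p * r \in @nonunital F G.
Proof. by rewrite !inE const1gM => /eqP->; rewrite mul0r. Qed.

Lemma nonunital_word v s : word (v :: s) \in @nonunital F G.
Proof. by rewrite inE const_word. Qed.

Lemma nonunital_xvar i h : xvar F i h \in @nonunital F G.
Proof.
by have := nonunital_word (i, h) [::]; rewrite /word big_seq1.
Qed.

Lemma nonunital_ind (U : freealg F G -> Prop) :
  subspace U -> (forall v s, U (word (v :: s))) ->
  forall p, p \in @nonunital F G -> U p.
Proof.
move=> sU Uw p; rewrite inE (freealgE p) => /eqP p0.
rewrite big_seq; apply: subspace_sum => // m; rewrite -mcoeff_neq0 => pm.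
apply: subspaceZ => //; case: m pm => -[|v s] pm; last exact: Uw.
by move: pm; rewrite -fmoneE (freealgE p) p0 eqxx.
Qed.

Lemma nonunital_split (p : freealg F G) :
  exists c r, p = c%:A + r /\ r \in @nonunital F G.
Proof.
exists p@_mone, (p - (p@_mone)%:A); split; first by rewrite addrC subrK.
by rewrite inE mcoeffB mcoeffZ mcoeff1 eqxx mulr1 subrr.
Qed.

(** * Evaluation in an algebra *)

Section Evaluation.
Variables (A : algType F).
Implicit Type a : nat -> G -> A.

Definition eval_word a (m : {fmonom gvar}) : A :=
  \prod_(v <- (m : seq gvar)) a v.1 v.2.

Lemma eval_word_mmorphism a : mmorphism (eval_word a).
Proof.
by split => [m1 m2|]; rewrite /eval_word ?fmM ?big_cat // fm1 big_nil.
Qed.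

HB.instance Definition _ a := isMultiplicative.Build {fmonom gvar} A
  (eval_word a) (eval_word_mmorphism a).

(** Evaluation is the map induced by a monoid morphism on words; its linearity and multiplicativity
    are derived from this. *)
Lemma free_eval_mmap a p : free_eval a p = mmap (in_alg A) (eval_word a) p.
Proof. by apply: eq_bigr => m _; rewrite -scalerAl mul1r. Qed.

Lemma free_eval_linear a c p r :
  free_eval a (c *: p + r) = c *: free_eval a p + free_eval a r.
Proof.
rewrite !free_eval_mmap mmapD; congr (_ + _).
by rewrite mmapZ -scalerAl mul1r.
Qed.

Lemma subspace_free_eval a (U : A -> Prop) :
  subspace U -> subspace (fun p => U (free_eval a p)).
Proof.
move=> [U0 Ulin]; split=> [|c u v Uu Uv].
  by rewrite free_eval_mmap mmap0.
by rewrite free_eval_linear; apply: Ulin.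
Qed.

Lemma free_evalD a : {morph free_eval a : p r / p + r}.
Proof. by move=> p r; rewrite -[p]scale1r free_eval_linear !scale1r. Qed.

Lemma free_eval0 a : free_eval a 0 = 0.
Proof. by rewrite free_eval_mmap mmap0. Qed.

Lemma free_evalZ a c p : free_eval a (c *: p) = c *: free_eval a p.
Proof. by rewrite -[_ *: p]addr0 free_eval_linear free_eval0 addr0. Qed.

Lemma free_evalN a p : free_eval a (- p) = - free_eval a p.
Proof. by rewrite -scaleN1r free_evalZ scaleN1r. Qed.

Lemma free_evalB a p r : free_eval a (p - r) = free_eval a p - free_eval a r.
Proof. by rewrite free_evalD free_evalN. Qed.

Lemma free_evalM a : {morph free_eval a : p r / p * r}.
Proof.
move=> p r; rewrite !free_eval_mmap.
apply: (commr_mmap_is_multiplicative _).1 => /= q m m'.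
by rewrite /GRing.comm -scalerAl -scalerAr mul1r mulr1.
Qed.

Lemma free_eval1 a : free_eval a 1 = 1.
Proof. by rewrite free_eval_mmap mmap1. Qed.

Lemma free_evalX a p n : free_eval a (p ^+ n) = free_eval a p ^+ n.
Proof.
by elim: n => [|n IH]; rewrite ?expr0 ?free_eval1 // !exprS free_evalM IH.
Qed.

Lemma free_eval_xvar a i h : free_eval a (xvar F i h) = a i h.
Proof.
by rewrite free_eval_mmap mmapU /= scale1r mul1r /eval_word fmU big_seq1.
Qed.

Lemma free_eval_word a s : free_eval a (word s) = \prod_(v <- s) a v.1 v.2.
Proof.
rewrite /word (big_morph _ (free_evalM a) (free_eval1 a)).
by apply: eq_bigr => v _; rewrite free_eval_xvar.
Qed.

(** Universal property of the free algebra without unit. As [psi] is a homomorphism only where the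
    constant term is zero, membership in [nonunital] is carried through the induction. *)
Lemma nonunital_hom_eval (psi : freealg F G -> A) :
  (forall c p r, p \in @nonunital F G -> r \in @nonunital F G ->
    psi (c *: p + r) = c *: psi p + psi r) ->
  (forall p r, p \in @nonunital F G -> r \in @nonunital F G ->
    psi (p * r) = psi p * psi r) ->
  forall p, p \in @nonunital F G ->
    psi p = free_eval (fun i h => psi (xvar F i h)) p.
Proof.
move=> lin mul p np; pose a i h := psi (xvar F i h).
have z0 := nonunital_subspace.1.
suff: p \in @nonunital F G /\ psi p = free_eval a p by case.
move: p np; apply: nonunital_ind => [|v s].
  split.
    split=> //; rewrite free_eval0; have := lin 1 0 0 z0 z0.
    by rewrite !scale1r addr0 => /eqP; rewrite -{1}[psi 0]addr0 (inj_eq (addrI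
      _)) eq_sym => /eqP.
  move=> c u w [nu pu] [nw pw]; split; first exact: nonunital_subspace.2.
  by rewrite lin // pu pw free_eval_linear.
split; first exact: nonunital_word.
elim: s v => [|w s IH] v.
  by rewrite /word big_seq1 free_eval_xvar.
have -> : word (v :: w :: s) = xvar F v.1 v.2 * word (w :: s).
  by rewrite /word big_cons.
rewrite mul ?nonunital_xvar ?nonunital_word // IH free_evalM.
by rewrite free_eval_xvar.
Qed.

End Evaluation.

(** Unlike [free_comp], this allows a constant term in degree 1, so that the component of degree 1
    is a unital subalgebra. *)
Definition homogeneous (h : G) (p : freealg F G) : Prop :=
  {in msupp p, forall m, word_deg m = h}.

Definition seq_deg (s : seq gvar) : G := (\prod_(v <- s) v.2)%g.

Lemma homogeneous_subspace h : subspace (homogeneous h).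
Proof.
split=> [m|c u v hu hv m]; first by rewrite msupp0 inE.
move=> /(fsubsetP (msuppD_le _ _)); rewrite in_fsetU => /orP[|]; last exact: hv.
by move/(fsubsetP (msuppZ_le _ _)); apply: hu.
Qed.

Lemma homogeneous_word s : homogeneous (seq_deg s) (word s).
Proof.
have := monom_word (FMonom s) => /= <- m.
by rewrite msuppU1 inE => /eqP->.
Qed.

Lemma homogeneous_ind h (U : freealg F G -> Prop) :
  subspace U -> (forall s, seq_deg s = h -> U (word s)) ->
  forall p, homogeneous h p -> U p.
Proof.
move=> sU Uw p hp; rewrite (freealgE p) big_seq.
by apply: subspace_sum => // m pm; apply: subspaceZ => //; apply: Uw; apply: hp.
Qed.

Lemma seq_deg_cat s t : seq_deg (s ++ t) = (seq_deg s * seq_deg t)%g.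
Proof. by rewrite /seq_deg big_cat. Qed.

Lemma wordM s t : word s * word t = word (s ++ t).
Proof. by rewrite /word big_cat. Qed.

Lemma homogeneousM h k p r :
  homogeneous h p -> homogeneous k r -> homogeneous (h * k)%g (p * r).
Proof.
move=> hp hr; have sub := homogeneous_subspace (h * k)%g.
move: p hp; apply: homogeneous_ind => [|s sh]; first exact: subspace_mulr.
move: r hr; apply: homogeneous_ind => [|t th]; first exact: subspace_mull.
by rewrite wordM -sh -th -seq_deg_cat; apply: homogeneous_word.
Qed.

Lemma homogeneous1 : homogeneous 1%g 1.
Proof.
by have := @homogeneous_word [::]; rewrite /word /seq_deg !big_nil.
Qed.

Lemma homogeneous_xvar i h : homogeneous h (xvar F i h).
Proof.
by have := @homogeneous_word [:: (i, h)]; rewrite /word /seq_deg !big_seq1.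
Qed.

Lemma homogeneous_nonunital h p :
  h != 1%g -> homogeneous h p -> p \in @nonunital F G.
Proof.
move=> h1 hp; rewrite inE; apply/negPn/negP; rewrite mcoeff_neq0 => /hp.
by rewrite /word_deg fm1 big_nil => /eqP; rewrite eq_sym (negbTE h1).
Qed.

(** * Graded evaluations and substitutions *)

Section GradedEvaluation.
Variables (A : algType F) (Agr : G -> A -> Prop).
Hypothesis Agr_sub : forall h, subspace (Agr h).
Hypothesis Agr1 : Agr 1%g 1.
Hypothesis AgrM :
  forall h k u v, Agr h u -> Agr k v -> Agr (h * k)%g (u * v).

Lemma free_eval_graded (a : nat -> G -> A) h p :
  (forall i k, Agr k (a i k)) -> homogeneous h p -> Agr h (free_eval a p).
Proof.
move=> aP; move: p; apply: homogeneous_ind; first exact: subspace_free_eval.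
move=> s <-; rewrite free_eval_word /seq_deg.
elim: s => [|v s IH]; first by rewrite !big_nil.
by rewrite !big_cons; apply: AgrM.
Qed.

End GradedEvaluation.

Lemma free_eval_nonunital (a : nat -> G -> freealg F G) p :
  (forall i h, a i h \in @nonunital F G) ->
  p \in @nonunital F G -> free_eval a p \in @nonunital F G.
Proof.
move=> na; move: p; apply: nonunital_ind => [|v s].
  exact: (subspace_free_eval a nonunital_subspace).
by rewrite free_eval_word big_cons; apply: nonunitalMr.
Qed.

Lemma free_eval_endo (a : nat -> G -> freealg F G) :
  (forall i h, free_comp h (a i h)) -> graded_endo (free_eval a).
Proof.
move=> aP; split=> [c p r _ _|p r _ _|h p [np hp]].
- exact: free_eval_linear.
- exact: free_evalM.
split; first by apply: free_eval_nonunital => // i k; case: (aP i k).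
apply: (free_eval_graded homogeneous_subspace homogeneous1 homogeneousM) => //.
by move=> i k; case: (aP i k).
Qed.

Lemma TG_subst (I : freealg F G -> Prop) p (a : nat -> G -> freealg F G) :
  TG_ideal I -> (forall i h, free_comp h (a i h)) -> I p -> I (free_eval a p).
Proof. by move=> tI aP Ip; exact: (TG_endo tI (free_eval_endo aP) Ip). Qed.

Lemma TG_subspace (I : freealg F G -> Prop) : TG_ideal I -> subspace I.
Proof. by move=> tI; split; [apply: TG_0 tI | apply: TG_linear tI]. Qed.

(** A T_G-ideal absorbs factors without constant term by definition; the constant term of a factor
    only scales. *)
Lemma TG_two_sided (I : freealg F G -> Prop) : TG_ideal I -> two_sided_ideal I.
Proof.
move=> tI; have sI := TG_subspace tI; split=> // a u Iu;
  have [c [r [-> nr]]] := nonunital_split a.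
- rewrite mulrDl -scalerAl mul1r; apply: sI.2 => //.
  exact: (TG_mull tI).
- rewrite mulrDr -scalerAr mulr1; apply: sI.2 => //.
  exact: (TG_mulr tI).
Qed.

Lemma free_comp_xvar i (h : G) : free_comp h (xvar F i h).
Proof. by split; [apply: nonunital_xvar | apply: homogeneous_xvar]. Qed.

(** * The T_G-ideal of identities of a graded algebra *)

Section Identities.
Variables (A : algType F) (Agr : G -> {pred A}).
Hypothesis Agr_sub : forall h, subspace (fun u => u \in Agr h).
Hypothesis Agr1 : 1 \in Agr 1%g.
Hypothesis AgrM :
  forall h k u v, u \in Agr h -> v \in Agr k -> u * v \in Agr (h * k)%g.

(** For a graded endomorphism phi, evaluating phi(p) at [a] amounts to evaluating p at the values of
    the phi(x_{i,h}), and these have degree h. *)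
Lemma graded_identity_TG : TG_ideal (graded_identity Agr).
Proof.
split.
- by move=> p [].
- by split; [apply: nonunital_subspace.1 | move=> a _; apply: free_eval0].
- move=> c p r [np ep] [nr er]; split; first exact: nonunital_subspace.2.
  by move=> a aP; rewrite free_eval_linear ep // er // scaler0 addr0.
- move=> p r _ [nr er]; split; first exact: nonunitalMl.
  by move=> a aP; rewrite free_evalM er // mulr0.
- move=> p r [np ep] _; split; first exact: nonunitalMr.
  by move=> a aP; rewrite free_evalM ep // mul0r.
move=> phi p [plin pmul pgr] [np ep].
(* Words are homogeneous, so linearity and the preservation of each [free_comp] suffice. *)
have nphi r : r \in @nonunital F G -> phi r \in @nonunital F G.
  move=> nr; suff: r \in @nonunital F G /\ phi r \in @nonunital F G by case.
  move: r nr; apply: nonunital_ind => [|v s].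
    have [n0 nlin] := nonunital_subspace; split=> [|c u w [nu pu] [nw pw]].
      split=> //; have [] // := pgr 1%g 0.
      by split=> //; apply: (homogeneous_subspace 1%g).1.
    by split; [apply: nlin | rewrite plin //; apply: nlin].
  split; first exact: nonunital_word.
  have [] // := pgr (seq_deg (v :: s)) (word (v :: s)).
  by split; [apply: nonunital_word | apply: homogeneous_word].
split; first exact: nphi.
move=> a aP.
have -> : free_eval a (phi p) =
    free_eval (fun i h => free_eval a (phi (xvar F i h))) p.
  apply: (nonunital_hom_eval (psi := fun r => free_eval a (phi r))) => //.
    by move=> c u v nu nv; rewrite plin // free_eval_linear.
  by move=> u v nu nv; rewrite pmul // free_evalM.
apply: ep => i h.
have [_ hx] := pgr h (xvar F i h) (free_comp_xvar i h).
exact: (free_eval_graded (Agr := fun h u => u \in Agr h)).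
Qed.

End Identities.
End FreeAlgebra.

(** * Identities of 2x2 matrices *)

Section Matrices2.
Variable R : comNzRingType.

Definition mx2 (a b c d : R) : 'M[R]_2 :=
  \matrix_(i, j) if i == 0 then if j == 0 then a else b
                 else if j == 0 then c else d.

Lemma mx2E a b c d : (mx2 a b c d 0 0 = a) * (mx2 a b c d 0 1 = b) *
  (mx2 a b c d 1 0 = c) * (mx2 a b c d 1 1 = d).
Proof. by rewrite !mxE. Qed.

Lemma mx2P (A B : 'M[R]_2) :
  [/\ A 0 0 = B 0 0, A 0 1 = B 0 1, A 1 0 = B 1 0 & A 1 1 = B 1 1] -> A = B.
Proof.
case=> h1 h2 h3 h4; apply/matrixP => i j.
have ord2 (k : 'I_2) : k = 0 \/ k = 1.
  by case: k => [[|[|]] lt] //; [left | right]; apply: val_inj.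
by case: (ord2 i) => ->; case: (ord2 j) => ->.
Qed.

Lemma mx2_eta (A : 'M[R]_2) : A = mx2 (A 0 0) (A 0 1) (A 1 0) (A 1 1).
Proof. by apply: mx2P; rewrite !mx2E. Qed.

Lemma mx2_entry_mul (A B : 'M[R]_2) i j :
  (A * B) i j = A i 0 * B 0 j + A i 1 * B 1 j.
Proof.
rewrite -mulmxE mxE big_ord_recl big_ord_recl big_ord0 addr0.
by congr (_ + A i _ * B _ j); apply: val_inj.
Qed.

Lemma mx2M a b c d a' b' c' d' : mx2 a b c d * mx2 a' b' c' d' =
  mx2 (a * a' + b * c') (a * b' + b * d') (c * a' + d * c') (c * b' + d * d').
Proof. by apply: mx2P; rewrite !mx2_entry_mul !mx2E. Qed.

Lemma mx2D a b c d a' b' c' d' : mx2 a b c d + mx2 a' b' c' d' =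
  mx2 (a + a') (b + b') (c + c') (d + d').
Proof. by apply: mx2P; rewrite !mxE. Qed.

Lemma mx2Z k a b c d : k *: mx2 a b c d = mx2 (k * a) (k * b) (k * c) (k * d).
Proof. by apply: mx2P; rewrite !mxE. Qed.

Lemma mx2_0 : 0 = mx2 0 0 0 0.
Proof. by apply: mx2P; rewrite !mxE. Qed.

Lemma mx2_1 : 1 = mx2 1 0 0 1.
Proof. by apply: mx2P; rewrite !mxE. Qed.

Lemma mx2_diagX a d n : mx2 a 0 0 d ^+ n = mx2 (a ^+ n) 0 0 (d ^+ n).
Proof.
elim: n => [|n IH]; first by rewrite !expr0 mx2_1.
by rewrite !exprS IH mx2M !(mulr0, mul0r, addr0, add0r).
Qed.

Lemma nilpotent_det (N : 'M[R]_2) : N * N = 0 ->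
  [/\ N 0 0 * N 0 0 + N 0 1 * N 1 0 = 0,
      N 0 0 * N 0 1 + N 0 1 * N 1 1 = 0,
      N 1 0 * N 0 0 + N 1 1 * N 1 0 = 0
    & N 1 0 * N 0 1 + N 1 1 * N 1 1 = 0].
Proof. by move=> N2; rewrite -!mx2_entry_mul N2 !mxE. Qed.

End Matrices2.

(** * Square-zero matrices and the identity f_2 *)

Section SquareZero.
Variables (F : finFieldType) (N : 'M[F]_2).
Hypothesis N2 : N * N = 0.

(** Trace and determinant vanish. If [N 0 1] is nonzero, it cancels from the (0,1) entry of N^2;
    otherwise both diagonal entries have square 0. *)
Lemma square_zero_entries : N 1 1 = - N 0 0 /\ N 0 0 * N 0 0 = - (N 0 1 * N 1
  0).
Proof.
have [h1 h2 h3 h4] := nilpotent_det N2.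
have h : N 0 0 * N 0 0 = - (N 0 1 * N 1 0).
  by apply/eqP; rewrite -addr_eq0 h1.
split=> //; apply/eqP; rewrite -addr_eq0 addrC.
have [bz|bnz] := eqVneq (N 0 1) 0; last first.
  rewrite -(inj_eq (mulfI bnz)) mulr0 -h2; apply/eqP; ring.
move: h4 h; rewrite bz mulr0 mul0r add0r oppr0 => /eqP; rewrite mulf_eq0 orbb.
by move=> /eqP -> /eqP; rewrite mulf_eq0 orbb => /eqP ->; rewrite addr0.
Qed.

(** N has rank at most 1: for N = u v with a column u and a row v, N A N = u (v A u) v, and v A u is
    the trace of A N. The proof checks this on entries. *)
Lemma square_zero_sandwich (A : 'M[F]_2) : N * A * N = \tr (A * N) *: N.
Proof.
have [h1 h2] := square_zero_entries.
have -> : \tr (A * N) = (A * N) 0 0 + (A * N) 1 1.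
  rewrite /mxtrace !big_ord_recl big_ord0 addr0.
  by congr (_ + (A * N) _ _); apply: val_inj.
move: h1 h2; rewrite (mx2_eta A) (mx2_eta N) !mx2E !mx2M !mx2E mx2Z.
move: (A 0 0) (A 0 1) (A 1 0) (A 1 1) (N 0 0) (N 0 1) (N 1 0) (N 1 1).
move=> x y z w a b c d -> aa.
have bc : b * c = - (a * a) by rewrite aa opprK.
by congr mx2; rewrite -?bc; ring: bc.
Qed.

(** For nonzero N the image and the kernel are the same line, and N A N = 0 says that A maps this
    line into itself. *)
Lemma square_zero_eigen (A : 'M[F]_2) :
  N * A * N = 0 -> exists mu, A * N = mu *: N.
Proof.
move=> NAN; have [N0|Nnz] := eqVneq N 0.
  by exists 0; rewrite N0 mulr0 scaler0.
have tr0 : \tr (A * N) = 0.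
  apply/eqP; move: NAN; rewrite square_zero_sandwich => /eqP.
  by rewrite scaler_eq0 (negbTE Nnz) orbF.
have [h1 h2] := square_zero_entries.
have trE : \tr (A * N) = (A * N) 0 0 + (A * N) 1 1.
  rewrite /mxtrace !big_ord_recl big_ord0 addr0.
  by congr (_ + (A * N) _ _); apply: val_inj.
move: trE h1 h2 Nnz; rewrite tr0 (mx2_eta A) (mx2_eta N) !mx2E !mx2M !mx2E.
move: (A 0 0) (A 0 1) (A 1 0) (A 1 1) (N 0 0) (N 0 1) (N 1 0) (N 1 1).
move=> x y z w a b c d /[swap] -> t0 aa Nnz.
have bc : b * c = - (a * a) by rewrite aa opprK.
have wa : w * a = x * a + y * c + z * b by rewrite -[LHS]addr0 [X in _ + X]t0;
  ring.
have [b0|bnz] := eqVneq b 0; last first.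
  (* The eigenvalue is read off from the (0,1) entry of A N = mu N, and from the (1,0) entry when b
     = 0. *)
  exists ((x * b - y * a) / b); rewrite mx2Z.
  congr mx2; apply: (mulfI bnz); field: bc wa; exact: bnz.
have [c0|cnz] := eqVneq c 0.
  move: aa Nnz; rewrite b0 c0 mulr0 oppr0 => /eqP;
    rewrite mulf_eq0 orbb => /eqP->.
  by rewrite oppr0 -mx2_0 eqxx.
exists ((z * a + w * c) / c); rewrite mx2Z.
congr mx2; apply: (mulfI cnz); field: bc wa; exact: cnz.
Qed.

Lemma eigen_exp (A : 'M[F]_2) mu n : A * N = mu *: N -> A ^+ n * N = mu ^+ n *:
  N.
Proof.
move=> AN; elim: n => [|n IH]; first by rewrite !expr0 mul1r scale1r.
by rewrite exprSr -mulrA AN -scalerAr IH scalerA exprS.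
Qed.

Lemma scalar_add_exp (l : F) n : (l%:A + N) ^+ n.+1 = (l ^+ n.+1)%:A + (l ^+ n
  *+ n.+1) *: N.
Proof.
elim: n => [|n IH]; first by rewrite !expr1 expr0 mulr1n scale1r.
rewrite exprS IH mulrDl !mulrDr -!scalerAl !mul1r -!scalerAr mulr1 N2 scaler0
  addr0.
rewrite !scalerA -!exprS -addrA -scalerDl; congr (_ + _ *: _).
by rewrite mulrnAr -exprS [RHS]mulrSr.
Qed.

End SquareZero.

Lemma card_natr0 (F : finFieldType) : #|F|%:R = 0 :> F.
Proof.
have: \sum_(x : F) (x + 1) = \sum_(x : F) x.
  by rewrite [RHS](reindex_inj (addIr 1)).
rewrite big_split sumr_const /= => /eqP.
by rewrite -{2}[\sum_(x : F) x]addr0 (inj_eq (addrI _)) => /eqP.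
Qed.

(** The characteristic polynomial divides X^(q^2) - X if it is irreducible, and X^q - X if it has
    two distinct roots in F; for a double root l, Cayley-Hamilton gives (B - l)^2 = 0. *)
Lemma power_or_square_zero (F : finFieldType) (B : 'M[F]_2) :
  B ^+ (#|F| ^ 2) = B \/ exists l, (B - l%:A) * (B - l%:A) = 0.
Proof.
pose chi := char_poly B.
have hornerB P : chi %| P -> horner_mx B P = 0.
  by case/dvdpP => Q ->; rewrite rmorphM /= Cayley_Hamilton mulr0.
have sz : size chi = 3 by rewrite size_char_poly.
have mon : chi \is monic by apply: char_poly_monic.
case: (pickP (root chi)) => [l chil|nroot]; last first.
  have irr : monic_irreducible_poly chi.
    by split=> //; apply: cubic_irreducible => [|x]; rewrite ?sz ?nroot.
  left; apply/eqP; rewrite -subr_eq0; apply/eqP.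
  have -> : B ^+ (#|F| ^ 2) - B = horner_mx B ('X^(#|F| ^ 2) - 'X).
    by rewrite rmorphB rmorphXn /= horner_mx_X.
  apply: hornerB.
  (* The quotient by chi is a field with q^2 elements, so the class of X equals its power q^2. *)
  have := expf_card (in_qpoly chi 'X : {poly %/ chi with irr}).
  rewrite card_qfpoly sz /= => e.
  have {e}: in_qpoly chi ('X^(#|F| ^ 2) - 'X) = 0.
    by rewrite rmorphB rmorphXn /= -[X in X - _]/((in_qpoly chi 'X : {poly %/
      chi with irr}) ^+ _) e subrr.
  move/(congr1 val) => /=; rewrite (mk_monicE irr).
  by rewrite -Pdiv.IdomainMonic.modpE // => /eqP; rewrite -/(dvdp _ _).
have /factor_theorem[r chiE] := chil.
have monr : r \is monic.
  by move: mon; rewrite chiE monicMr // monicXsubC.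
have szr : size r = 2.
  by move: sz; rewrite chiE size_Mmonic ?monicXsubC ?monic_neq0 //
    size_XsubC addn2 => -[].
have [m rE] : exists m, r = 'X - m%:P.
  exists (- r`_0); rewrite polyCN opprK; apply/polyP => -[|[|k]].
  - by rewrite coefD coefX coefC add0r.
  - rewrite coefD coefX coefC addr0; move/monicP: monr.
    by rewrite lead_coefE szr.
  - by rewrite coefD coefX coefC addr0 nth_default // szr.
have [ml|ml] := eqVneq m l.
  right; exists l; rewrite -(Cayley_Hamilton B) -/chi chiE rE ml.
  by rewrite rmorphM rmorphB /= horner_mx_X horner_mx_C scalemx1.
left; suff Bq : B ^+ #|F| = B by rewrite expnS expn1 exprM !Bq.
apply/eqP; rewrite -subr_eq0; apply/eqP.
have -> : B ^+ #|F| - B = horner_mx B ('X^#|F| - 'X).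
  by rewrite rmorphB rmorphXn /= horner_mx_X.
apply: hornerB; rewrite chiE rE.
have -> : ('X - m%:P) * ('X - l%:P) = \prod_(z <- [:: m; l]) ('X - z%:P).
  by rewrite big_cons big_seq1.
apply: uniq_roots_dvdp; last by rewrite uniq_rootsE /= inE ml.
have vanish (c : F) : root ('X^#|F| - 'X) c.
  by rewrite /root !hornerE expf_card subrr.
by rewrite /= !vanish.
Qed.

(** If B = l + N with N^2 = 0, then N [A, B]^n = t^n N with t the trace of A N. For nonzero t,
    t^(q-1) = 1 and the two terms cancel; for t = 0, A N = mu N and so (A - A^q) N = 0. *)
Lemma M2_identity (F : finFieldType) (A B : 'M[F]_2) :
  let u := (A - A ^+ #|F|) * (B - B ^+ (#|F| ^ 2)) in
  u - u * (A * B - B * A) ^+ (#|F| - 1) = 0.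
Proof.
have q_gt0 : (0 < #|F|)%N by rewrite ltnW ?finNzRing_gt1.
have q1_gt0 : (0 < #|F| - 1)%N by rewrite subn_gt0 finNzRing_gt1.
case: (power_or_square_zero B) => [->|[l]] /=;
  first by rewrite subrr mulr0 mul0r subrr.
have BE0 : B = l%:A + (B - l%:A) by rewrite addrC subrK.
move: (B - l%:A) BE0 => N BE N2.
(* In (l + N)^(q^2) the coefficient of N is a multiple of q, hence 0, and l^(q^2) = l. *)
have -> : B - B ^+ (#|F| ^ 2) = N.
  have q2 : (0 < #|F| ^ 2)%N by rewrite expn_gt0 q_gt0.
  rewrite {1 2}BE -(prednK q2) scalar_add_exp // prednK //.
  rewrite expnS expn1 mulrnA -[_ *+ #|F| *+ _]mulr_natr card_natr0 mulr0
    scale0r addr0.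
  by rewrite exprM !expf_card addrC addKr.
have -> : A * B - B * A = A * N - N * A.
  rewrite BE mulrDr mulrDl -scalerAl -scalerAr mulr1 mul1r.
  by rewrite opprD addrACA subrr add0r.
have NC n : N * (A * N - N * A) ^+ n = (\tr (A * N)) ^+ n *: N.
  elim: n => [|n IH]; first by rewrite !expr0 mulr1 scale1r.
  rewrite [in LHS]exprSr mulrA IH -scalerAl mulrBr !mulrA N2 mul0r subr0.
  by rewrite square_zero_sandwich // scalerA exprSr.
rewrite -mulrA NC.
have [c0|c_neq0] := eqVneq (\tr (A * N)) 0; last first.
  rewrite (_ : _ ^+ (#|F| - 1) = 1) ?scale1r ?subrr //.
  by apply: (mulfI c_neq0); rewrite -exprS subn1 prednK // expf_card mulr1.
rewrite c0 expr0n eqn0Ngt q1_gt0 scale0r mulr0 subr0.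
have [|mu AN] := square_zero_eigen N2 (A := A).
  by rewrite square_zero_sandwich // c0 scale0r.
by rewrite mulrBl (eigen_exp _ AN) AN expf_card subrr.
Qed.

(** * The grading on 2x2 matrices *)

Section GradedM2.
Variables (F : fieldType) (G : groupType) (g : G).

Lemma M2_comp_unit a d : mx2 a 0 0 d \in @M2_comp F G g 1%g.
Proof. by rewrite inE eqxx !mx2E !eqxx. Qed.

(** If g were its own inverse, every power of g would be 1 or g. This is where cyclicity and |G| > 2
    enter. *)
Lemma cyclic_generator_neq : cyclic_generator g -> card_gt G 2 -> g^-1%g != g.
Proof.
move=> gen [s [us]]; rewrite ltnNge; apply: contraNneq => gg.
have g2 : (g * g = 1)%g by rewrite -{1}gg mulVg.
apply: (@uniq_leq_size _ s [:: 1%g; g]) => // h _.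
have pow n : (g ^+ n)%g \in [:: 1%g; g].
  elim: n => [|n]; first by rewrite expg0 mem_head.
  by rewrite !inE expgS => /orP[]/eqP->; rewrite ?mulg1 ?g2 eqxx ?orbT.
have [n [->|->]] := gen h; first exact: pow.
have -> : (g ^- n = (g^-1) ^+ n)%g by rewrite expVgn.
by rewrite gg.
Qed.

Hypothesis gVg : g^-1%g != g.

Lemma generator_neq1 : g != 1%g.
Proof. by apply: contraNneq gVg => ->; rewrite invg1. Qed.

Lemma M2_comp_g b : mx2 0 b 0 0 \in @M2_comp F G g g.
Proof. by rewrite inE (negbTE generator_neq1) eqxx !mx2E !eqxx. Qed.

Lemma M2_comp_gV c : mx2 0 0 c 0 \in @M2_comp F G g g^-1%g.
Proof.
rewrite inE (negbTE gVg) invg_eq1 (negbTE generator_neq1) eqxx.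
by rewrite !mx2E !eqxx.
Qed.

Lemma M2_comp_subspace h : subspace (fun A => A \in @M2_comp F G g h).
Proof.
split=> [|c A B]; rewrite !inE; first by rewrite !mxE !eqxx !if_same.
case: ifP => _.
  by move=> /andP[/eqP a /eqP b] /andP[/eqP a' /eqP b'];
    rewrite !mxE a b a' b' mulr0 addr0 eqxx.
do 2![case: ifP => _; first by move=> /and3P[/eqP a /eqP b /eqP d] /and3P[/eqP
  a' /eqP b' /eqP d'];
  rewrite !mxE a b d a' b' d' mulr0 addr0 eqxx].
by move=> /eqP-> /eqP->; rewrite scaler0 addr0.
Qed.

Lemma M2_comp_1P A : A \in @M2_comp F G g 1%g -> exists a d, A = mx2 a 0 0 d.
Proof.
rewrite inE eqxx => /andP[/eqP b /eqP c].
by exists (A 0 0), (A 1 1); rewrite [LHS]mx2_eta b c.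
Qed.

Lemma M2_comp_gP A : A \in @M2_comp F G g g -> exists b, A = mx2 0 b 0 0.
Proof.
rewrite inE (negbTE generator_neq1) eqxx => /and3P[/eqP a /eqP c /eqP d].
by exists (A 0 1); rewrite [LHS]mx2_eta a c d.
Qed.

Lemma M2_comp_gVP A : A \in @M2_comp F G g g^-1%g -> exists c, A = mx2 0 0 c 0.
Proof.
rewrite inE (negbTE gVg) invg_eq1 (negbTE generator_neq1) eqxx.
move=> /and3P[/eqP a /eqP b /eqP d].
by exists (A 1 0); rewrite [LHS]mx2_eta a b d.
Qed.

Lemma M2_compP h A : A \in @M2_comp F G g h ->
  [\/ h = 1%g /\ exists a d, A = mx2 a 0 0 d,
      h = g /\ exists b, A = mx2 0 b 0 0,
      h = g^-1%g /\ exists c, A = mx2 0 0 c 0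
    | [/\ h != 1%g, h != g, h != g^-1%g & A = 0]].
Proof.
have [->|h1] := eqVneq h 1%g; first by move/M2_comp_1P; constructor 1.
have [->|hg] := eqVneq h g; first by move/M2_comp_gP; constructor 2.
have [->|hgV] := eqVneq h g^-1%g; first by move/M2_comp_gVP; constructor 3.
rewrite inE (negbTE h1) (negbTE hg) (negbTE hgV) => /eqP A0.
by constructor 4.
Qed.

(** Two matrices of degree g multiply to 0, and so do two of degree g^-1; hence the degrees g^2 and
    g^-2, which may coincide with g^-1 and g, require no separate case. *)
Lemma M2_compM h k A B : A \in @M2_comp F G g h -> B \in @M2_comp F G g k ->
  A * B \in @M2_comp F G g (h * k)%g.
Proof.
have zero l : 0 \in @M2_comp F G g l by apply: (M2_comp_subspace l).1.
case/M2_compP => [[->[a [d ->]]]|[->[b ->]]|[->[c ->]]|[_ _ _ ->]];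
  last by rewrite mul0r.
all: case/M2_compP => [[->[a' [d' ->]]]|[->[b' ->]]|[->[c' ->]]|[_ _ _ ->]];
  last by rewrite mulr0.
all: rewrite mx2M !(mulr0, mul0r, addr0, add0r) ?mul1g ?mulg1 ?mulgV ?mulVg.
all: by rewrite -?mx2_0 ?M2_comp_unit ?M2_comp_g ?M2_comp_gV ?zero.
Qed.

Lemma M2_identity_TG : TG_ideal (graded_identity (@M2_comp F G g)).
Proof.
apply: graded_identity_TG; first exact: M2_comp_subspace; last exact: M2_compM.
by rewrite mx2_1 M2_comp_unit.
Qed.

End GradedM2.

Lemma morph_f2 (R S : nzRingType) (phi : R -> S) :
  {morph phi : x y / x - y} -> {morph phi : x y / x * y} ->
  (forall x n, phi (x ^+ n) = phi x ^+ n) -> forall x y k m n,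
  phi ((x - x ^+ k) * (y - y ^+ m) - (x - x ^+ k) * (y - y ^+ m) * (x * y - y *
    x) ^+ n) =
  (phi x - phi x ^+ k) * (phi y - phi y ^+ m) -
  (phi x - phi x ^+ k) * (phi y - phi y ^+ m) * (phi x * phi y - phi y * phi x)
    ^+ n.
Proof. by move=> phiB phiM phiX x y k m n; rewrite !(phiB, phiM, phiX). Qed.

Lemma generators_identity (F : finFieldType) (G : groupType) (g : G) :
  g^-1%g != g -> forall p, @generators F G g #|F| p ->
  graded_identity (@M2_comp F G g) p.
Proof.
move=> gVg p; have q_gt0 : (0 < #|F|)%N by rewrite ltnW ?finNzRing_gt1.
have nz := @nonunital_xvar F G.
have nB := subspaceB (nonunital_subspace F G).
have nD := subspaceD (nonunital_subspace F G).
have nBM (u v : freealg F G) : u \in @nonunital F G ->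
    u - u * v \in @nonunital F G.
  by move=> nu; apply: (nB) => //; apply: nonunitalMr.
have nX (u : freealg F G) n : (0 < n)%N -> u \in @nonunital F G ->
    u ^+ n \in @nonunital F G.
  by case: n => // n _ nu; rewrite exprS; apply: nonunitalMr.
have X1 : Xvar F g 0 \in @nonunital F G.
  by apply: (nD); [apply: (nD)|]; exact: nz.
case=> [->|[->|[->|[->|[h [h1 hg hgV ->]]]]]]; split.
- by apply: (nB); [apply: (nX) => //|]; exact: nz.
- move=> a aP; rewrite /f1 free_evalB free_evalX free_eval_xvar.
  have [x [y ->]] := M2_comp_1P (aP 0 1%g).
  by rewrite mx2_diagX !expf_card subrr.
- have nu : (Xvar F g 0 - Xvar F g 0 ^+ #|F|) *
    (Xvar F g 1 - Xvar F g 1 ^+ (#|F| ^ 2)) \in @nonunital F G.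
    by apply: nonunitalMr; apply: (nB) => //; apply: (nX).
  exact: (nBM _ _ nu).
- move=> a aP; rewrite /f2 /lie /=; move: (Xvar F g 0) (Xvar F g 1) => x y.
  rewrite (morph_f2 (free_evalB a) (free_evalM a) (free_evalX a)).
  exact: M2_identity.
- by apply: nonunitalMr; exact: nz.
- move=> a aP; rewrite /f3 free_evalM !free_eval_xvar.
  have [b ->] := M2_comp_gP gVg (aP 0 g);
    have [b' ->] := M2_comp_gP gVg (aP 1 g).
  by rewrite mx2M !(mulr0, mul0r, addr0) -mx2_0.
- by apply: nonunitalMr; exact: nz.
- move=> a aP; rewrite /f4 free_evalM !free_eval_xvar.
  have [c ->] := M2_comp_gVP gVg (aP 0 g^-1%g).
  have [c' ->] := M2_comp_gVP gVg (aP 1 g^-1%g).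
  by rewrite mx2M !(mulr0, mul0r, addr0) -mx2_0.
- exact: nz.
- move=> a aP; rewrite free_eval_xvar; move: (aP 0 h).
  by rewrite inE (negbTE h1) (negbTE hg) (negbTE hgV) => /eqP.
Qed.

(** * Representations by 2x2 matrices *)

Section MatrixRepresentations.
Variables (F : finFieldType) (S : algType F).

Definition linear_on (V : S -> Prop) (f : S -> F) : Prop :=
  forall c u v, V u -> V v -> f (c *: u + v) = c * f u + f v.

Definition vanishes_on (I V : S -> Prop) (f : S -> F) : Prop :=
  forall u, V u -> I u -> f u = 0.

Record character (I E : S -> Prop) (chi : S -> F) : Prop := Character {
  character_linear : linear_on E chi;
  character_vanishes : vanishes_on I E chi;
  character1 : chi 1 = 1;
  characterM : forall a b, E a -> E b -> chi (a * b) = chi a * chi b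
}.

(* The entries of a homomorphism (chi1, s; r, chi2) to 2x2 matrices from the
   sum of E (diagonal), Z and W (off the diagonal), modulo I. *)
Record matrix_rep (I E Z W : S -> Prop) (chi1 chi2 s r : S -> F) : Prop :=
  MatrixRep {
    rep_chi1 : character I E chi1;
    rep_chi2 : character I E chi2;
    rep_s_linear : linear_on Z s;
    rep_r_linear : linear_on W r;
    rep_s_vanishes : vanishes_on I Z s;
    rep_r_vanishes : vanishes_on I W r;
    rep_sMl : forall a z, E a -> Z z -> s (a * z) = chi1 a * s z;
    rep_sMr : forall a z, E a -> Z z -> s (z * a) = s z * chi2 a;
    rep_rMl : forall a w, E a -> W w -> r (a * w) = chi2 a * r w;
    rep_rMr : forall a w, E a -> W w -> r (w * a) = r w * chi1 a;
    rep_zw : forall z w, Z z -> W w -> chi1 (z * w) = s z * r w;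
    rep_wz : forall z w, Z z -> W w -> chi2 (w * z) = r w * s z;
    rep_zw0 : forall z w, Z z -> W w -> chi2 (z * w) = 0;
    rep_wz0 : forall z w, Z z -> W w -> chi1 (w * z) = 0
  }.

(** Conjugation by the permutation matrix exchanges the two diagonal and the two off-diagonal
    entries; this transfers results from degree g to g^-1. *)
Lemma matrix_rep_flip I E Z W chi1 chi2 s r :
  matrix_rep I E W Z chi1 chi2 s r -> matrix_rep I E Z W chi2 chi1 r s.
Proof.
by case=> *; split=> // u v Zu Wv; auto.
Qed.

Variables I E Z W : S -> Prop.
Hypothesis idealI : two_sided_ideal I.
Hypothesis subalgE : subalgebra E.
Hypothesis E_power : forall a, E a -> I (a ^+ #|F| - a).

Let subI : subspace I. Proof. by case: idealI. Qed.
Let Il a u : I u -> I (a * u). Proof. by case: idealI => _ + _; apply. Qed.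
Let Ir a u : I u -> I (u * a). Proof. by case: idealI => _ _; apply. Qed.
Let subE : subspace E. Proof. by case: subalgE. Qed.
Let E1 : E 1. Proof. by case: subalgE. Qed.
Let EM a b : E a -> E b -> E (a * b). Proof. by case: subalgE => _ _;
  apply. Qed.

(** Since s(p) = 1, the eigenvalues are chi1(a) = s(a p) and chi2(a) = s(p a), and they inherit the
    properties of a character from [s]. *)
Lemma bimodule_characters (M : S -> Prop) (p : S) :
  subbimodule E M -> M p -> ~ I p -> exists chi1 chi2 s : S -> F,
  [/\ character I E chi1, character I E chi2,
      (forall a u, E a -> M u -> s (a * u) = chi1 a * s u) /\
      (forall a u, E a -> M u -> s (u * a) = s u * chi2 a),
      linear_on M s /\ vanishes_on I M s
    & s p = 1].
Proof.
move=> subM Mp nIp.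
have [chi1 [chi2 [s [sl sr slin s0 sp]]]] :=
  bimodule_character idealI subalgE E_power subM Mp nIp.
have [sM Ml Mr] := subM.
have c1 a : E a -> chi1 a = s (a * p) by move=> Ea; rewrite sl // sp mulr1.
have c2 a : E a -> chi2 a = s (p * a) by move=> Ea; rewrite sr // sp mul1r.
exists chi1, chi2, s; split=> //; split.
- move=> c u v Eu Ev; rewrite !c1 //; last exact: subE.2.
  by rewrite mulrDl -scalerAl slin //; apply: Ml.
- by move=> u Eu Iu; rewrite c1 // s0 //; [apply: Ml | apply: Ir].
- by rewrite c1 // mul1r.
- move=> a b Ea Eb; rewrite c1; last exact: EM.
  by rewrite -mulrA sl ?sl ?sp ?mulr1 //; apply: Ml.
- move=> c u v Eu Ev; rewrite !c2 //; last exact: subE.2.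
  by rewrite mulrDr -scalerAr slin //; apply: Mr.
- by move=> u Eu Iu; rewrite c2 // s0 //; [apply: Mr | apply: Il].
- by rewrite c2 // mulr1.
- move=> a b Ea Eb; rewrite c2; last exact: EM.
  by rewrite mulrA sr ?sr ?sp ?mul1r //; apply: Mr.
Qed.

Hypothesis subZ : subbimodule E Z.
Hypothesis subW : subbimodule E W.
Hypothesis ZW : forall z w, Z z -> W w -> E (z * w).
Hypothesis WZ : forall z w, Z z -> W w -> E (w * z).

(* As Z is one-dimensional modulo the kernel of [s], evaluating [z w z'] in two
   ways forces [chi1 (z w) = s z * chi2 (w p)]. *)
Lemma off_diagonal_rep (p : S) :
  (forall z z', Z z -> Z z' -> I (z * z')) -> Z p -> ~ I p ->
  exists chi1 chi2 s r, matrix_rep I E Z W chi1 chi2 s r /\ s p = 1.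
Proof.
move=> ZZ Zp nIp; have [_ Zl Zr] := subZ.
have [chi1 [chi2 [s [C1 C2 [sl sr] [slin s0] sp]]]] :=
  bimodule_characters subZ Zp nIp.
have [sW Wl Wr] := subW.
have chi1zw z w : Z z -> W w -> chi1 (z * w) = s z * chi2 (w * p).
  move=> Zz Ww; have := sl (z * w) p (ZW Zz Ww) Zp.
  by rewrite sp mulr1 => <-; rewrite -mulrA sr //; apply: WZ.
(* The form chi2(w p) of r(w) suits left multiplication by E, the form chi1(p w) right
   multiplication. *)
have r_eq w : W w -> chi2 (w * p) = chi1 (p * w).
  by move=> Ww; rewrite chi1zw // sp mul1r.
exists chi1, chi2, s, (fun w => chi2 (w * p)); split=> //; split=> //.
- move=> c u v Wu Wv; rewrite mulrDl -scalerAl (character_linear C2) //;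
  exact: WZ.
- move=> w Ww Iw; apply: (character_vanishes C2); [exact: WZ | exact: Ir].
- by move=> a w Ea Ww; rewrite -mulrA (characterM C2) //; apply: WZ.
- move=> a w Ea Ww; rewrite !r_eq //; last exact: Wr.
  by rewrite mulrA (characterM C1) //; apply: ZW.
- move=> z w Zz Ww; rewrite r_eq // -(sl _ _ (ZW Zp Ww) Zz).
  by rewrite -mulrA sr ?sp ?mul1r //; apply: WZ.
(* Here chi2(z w) = s(p z w) with p z in [I]; likewise chi1(w z) = s(w z p) below. *)
- move=> z w Zz Ww; have := sr _ _ (ZW Zz Ww) Zp; rewrite sp mul1r => <-.
  by apply: s0; [apply: Zr => //; apply: ZW | rewrite mulrA; apply: Ir;
    apply: ZZ].
- move=> z w Zz Ww; have := sl _ _ (WZ Zz Ww) Zp; rewrite sp mulr1 => <-.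
  by apply: s0; [apply: Zl => //; apply: WZ | rewrite -mulrA; apply: Il;
    apply: ZZ].
Qed.

(** E is taken as a bimodule over itself. Zero off-diagonal entries are admissible because chi
    vanishes on Z W and W Z. *)
Lemma diagonal_rep (p : S) : E p -> ~ I p ->
  (forall z, Z z -> I (p * z)) -> (forall z, Z z -> I (z * p)) ->
  exists chi, matrix_rep I E Z W chi chi (fun=> 0) (fun=> 0) /\ chi p != 0.
Proof.
move=> Ep nIp pZ Zp.
have subEE : subbimodule E E by split=> // a u Ea Eu; apply: EM.
have [chi1 [chi2 [s [C1 C2 [sl sr] [slin s0] sp]]]] :=
  bimodule_characters subEE Ep nIp.
(* 1 = s(p) = s(p 1) = chi1(p) s(1). *)
have p_neq0 : chi1 p != 0.
  apply/eqP => c0; have := sl p 1 Ep E1.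
  by rewrite mulr1 sp c0 mul0r => /eqP; rewrite oner_eq0.
have chip0 u : E u -> I (p * u) -> chi1 u = 0.
  move=> Eu Ipu; apply: (mulfI p_neq0); rewrite mulr0 -(characterM C1) //.
  by apply: (character_vanishes C1) => //; apply: EM.
have chi0p u : E u -> I (u * p) -> chi1 u = 0.
  move=> Eu Iup; apply: (mulIf p_neq0); rewrite mul0r -(characterM C1) //.
  by apply: (character_vanishes C1) => //; apply: EM.
have zw0 z w : Z z -> W w -> chi1 (z * w) = 0.
  move=> Zz Ww; apply: chip0; first exact: ZW.
  by rewrite mulrA; apply: Ir; apply: pZ.
have wz0 z w : Z z -> W w -> chi1 (w * z) = 0.
  move=> Zz Ww; apply: chi0p; first exact: WZ.
  by rewrite -mulrA; apply: Il; apply: Zp.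
exists chi1; split=> //; split=> //.
1,2: by move=> c u v _ _; rewrite mulr0 addr0.
1,2,3,4: by move=> a u _ _; rewrite ?mulr0 ?mul0r.
by move=> z w Zz Ww; rewrite mulr0 zw0.
by move=> z w Zz Ww; rewrite mulr0 wz0.
Qed.

End MatrixRepresentations.

(** * Consequences of the generators by substitution *)

Section Substitutions.
Variables (F : fieldType) (G : groupType) (I : freealg F G -> Prop).
Hypothesis TGI : TG_ideal I.

(** All variables of degree h after the first become v; the generators treated this way involve at
    most x_{1,h} and x_{2,h}. *)
Definition subst2 (h : G) (u v : freealg F G) (i : nat) (k : G) : freealg F G :=
  if k == h then if i == 0 then u else v else xvar F i k.

Lemma subst2_comp h u v i k :
  free_comp h u -> free_comp h v -> free_comp k (subst2 h u v i k).
Proof.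
rewrite /subst2 => hu hv; have [->|_] := eqVneq; last exact: free_comp_xvar.
by case: ifP.
Qed.

Lemma TG_subst2 h u v p : free_comp h u -> free_comp h v -> I p ->
  I (free_eval (subst2 h u v) p).
Proof.
by move=> hu hv; apply: (TG_subst TGI) => i k; apply: subst2_comp.
Qed.

Lemma TG_xvar0 h u : I (xvar F 0 h) -> free_comp h u -> I u.
Proof.
move=> Ix hu; have := TG_subst2 hu hu Ix.
by rewrite free_eval_xvar /subst2 !eqxx.
Qed.

Lemma TG_xvar_product h u v : I (xvar F 0 h * xvar F 1 h) ->
  free_comp h u -> free_comp h v -> I (u * v).
Proof.
move=> Ix hu hv; have := TG_subst2 hu hv Ix.
by rewrite free_evalM !free_eval_xvar /subst2 eqxx.
Qed.

Lemma TG_power n u : I (xvar F 0 1%g ^+ n - xvar F 0 1%g) ->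
  free_comp 1%g u -> I (u ^+ n - u).
Proof.
move=> Ix hu; have := TG_subst2 hu hu Ix.
by rewrite free_evalB free_evalX !free_eval_xvar /subst2 !eqxx.
Qed.

End Substitutions.

(** * Homogeneous parts of a polynomial *)

Section HomogeneousParts.
Variables (F : fieldType) (G : groupType).

(** A predicate on degrees, rather than one degree, lets all degrees other than 1, g, g^-1 be
    gathered in a single part. *)
Definition part (P : pred G) (p : freealg F G) : freealg F G :=
  \sum_(m <- msupp p | P (word_deg m)) p@_m *: word F (m : {fmonom (nat *
    G)%type}).

Lemma part_split (P : pred G) p : p = part P p + part (predC P) p.
Proof. by rewrite {1}(freealgE p) (bigID (fun m => P (word_deg m))). Qed.

Lemma part_split_sub (P Q : pred G) p : subpred Q P ->
  part P p = part Q p + part (predD P Q) p.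
Proof.
move=> QP; rewrite /part (bigID (fun m => Q (word_deg m))) /=; congr (_ + _).
  by apply: eq_bigl => m; apply: andb_idl; apply: QP.
by apply: eq_bigl => m; rewrite andbC.
Qed.

Lemma part_subspace (U : freealg F G -> Prop) (P : pred G) p :
  subspace U ->
  (forall s, P (seq_deg s) -> U (word F s)) -> U (part P p).
Proof.
move=> sU Uw; apply: subspace_sum => // m Pm; apply: subspaceZ => //.
exact: Uw.
Qed.

Lemma homogeneous_part h p : homogeneous h (part (pred1 h) p).
Proof.
move: p => p; apply: (part_subspace (U := homogeneous h)).
  exact: homogeneous_subspace.
by move=> s /eqP <-; apply: homogeneous_word.
Qed.

End HomogeneousParts.

(** * Identities lie in every T_G-ideal containing the generators *)

Section IdentitiesInIdeal.
Variables (F : finFieldType) (G : groupType) (g : G).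
Hypothesis gVg : g^-1%g != g.
Variable I : freealg F G -> Prop.
Hypothesis TGI : TG_ideal I.
Hypothesis I_gen : forall p, generators g #|F| p -> I p.

Local Notation E := (@homogeneous F G 1%g).
Local Notation Z := (@homogeneous F G g).
Local Notation W := (@homogeneous F G g^-1%g).

Let g1 : g != 1%g. Proof. exact: generator_neq1. Qed.
Let gV1 : g^-1%g != 1%g. Proof. by rewrite invg_eq1. Qed.
Let idealI := TG_two_sided TGI.
Let subI := TG_subspace TGI.

Let hom_comp (h : G) (u : freealg F G) : h != 1%g -> homogeneous h u ->
  free_comp h u.
Proof. by move=> h1 hu; split=> //; apply: homogeneous_nonunital hu. Qed.

Lemma other_degree h u :
  h != 1%g -> h != g -> h != g^-1%g -> homogeneous h u -> I u.
Proof.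
move=> h1 hg hgV hu; apply: (TG_xvar0 TGI (h := h)); last exact: hom_comp.
by apply: I_gen; do 4!right; exists h.
Qed.

Lemma product_degree_g u v : Z u -> Z v -> I (u * v).
Proof.
move=> Zu Zv; apply: (TG_xvar_product TGI (h := g)); [|exact: hom_comp..].
by apply: I_gen; do 2!right; left.
Qed.

Lemma product_degree_gV u v : W u -> W v -> I (u * v).
Proof.
move=> Wu Wv; apply: (TG_xvar_product TGI (h := g^-1%g)); [|exact: hom_comp..].
by apply: I_gen; do 3!right; left.
Qed.

Lemma homogeneous1_subalgebra : subalgebra E.
Proof.
split; [exact: homogeneous_subspace | exact: homogeneous1 |].
by move=> a b Ea Eb; rewrite -[1%g]mulg1; apply: homogeneousM.
Qed.

Lemma homogeneous_subbimodule h : subbimodule E (@homogeneous F G h).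
Proof.
split; first exact: homogeneous_subspace.
  by move=> a u Ea hu; rewrite -[h]mul1g; apply: homogeneousM.
by move=> a u Ea hu; rewrite -[h]mulg1; apply: homogeneousM.
Qed.

Lemma product_g_gV z w : Z z -> W w -> E (z * w).
Proof. by move=> Zz Ww; rewrite -(mulgV g); apply: homogeneousM. Qed.

Lemma product_gV_g z w : Z z -> W w -> E (w * z).
Proof. by move=> Zz Ww; rewrite -(mulVg g); apply: homogeneousM. Qed.

(** f_1 is applied to [a] minus its constant term, and the constant is added back afterwards. *)
Lemma homogeneous1_power a : E a -> I (a ^+ #|F| - a).
Proof.
move=> Ea; have [c [r [aE nr]]] := nonunital_split a.
have sE := homogeneous_subspace F (1 : G)%g.
have Er : E r.
  apply: (subspaceDr sE (u := c%:A)); first by rewrite -aE.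
  exact: (subalgebra_scalar homogeneous1_subalgebra).
rewrite aE; apply: (power_add_scalar idealI).
by apply: (TG_power TGI); [apply: I_gen; left | split].
Qed.

Section RepresentationEvaluation.
Variables chi1 chi2 s r : freealg F G -> F.
Hypothesis rep : matrix_rep I E Z W chi1 chi2 s r.

(** The degree is an argument because each entry function is controlled only on its own homogeneous
    component. *)
Definition rep_mx (h : G) (p : freealg F G) : 'M[F]_2 :=
  if h == 1%g then mx2 (chi1 p) 0 0 (chi2 p)
  else if h == g then mx2 0 (s p) 0 0
  else if h == g^-1%g then mx2 0 0 (r p) 0
  else 0.

Lemma rep_mx1 p : rep_mx 1%g p = mx2 (chi1 p) 0 0 (chi2 p).
Proof. by rewrite /rep_mx eqxx. Qed.

Lemma rep_mxg p : rep_mx g p = mx2 0 (s p) 0 0.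
Proof. by rewrite /rep_mx (negbTE g1) eqxx. Qed.

Lemma rep_mxgV p : rep_mx g^-1%g p = mx2 0 0 (r p) 0.
Proof. by rewrite /rep_mx (negbTE gV1) (negbTE gVg) eqxx. Qed.

Lemma rep_mx_comp h p : rep_mx h p \in @M2_comp F G g h.
Proof.
have [->|h1] := eqVneq h 1%g; first by rewrite rep_mx1 M2_comp_unit.
have [->|hg] := eqVneq h g; first by rewrite rep_mxg M2_comp_g.
have [->|hgV] := eqVneq h g^-1%g; first by rewrite rep_mxgV M2_comp_gV.
rewrite /rep_mx (negbTE h1) (negbTE hg) (negbTE hgV).
exact: (M2_comp_subspace F g h).1.
Qed.

Lemma rep_mx_vanishes h p : homogeneous h p -> I p -> rep_mx h p = 0.
Proof.
move=> hp Ip; rewrite /rep_mx.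
case: eqVneq hp => [->|_] hp.
  by rewrite (character_vanishes (rep_chi1 rep)) //
    (character_vanishes (rep_chi2 rep)) // -mx2_0.
case: eqVneq hp => [->|_] hp; first by rewrite (rep_s_vanishes rep) // -mx2_0.
case: eqVneq hp => [->|//] hp; by rewrite (rep_r_vanishes rep) // -mx2_0.
Qed.

Lemma rep_mx_linear h c p1 p2 : homogeneous h p1 -> homogeneous h p2 ->
  rep_mx h (c *: p1 + p2) = c *: rep_mx h p1 + rep_mx h p2.
Proof.
rewrite /rep_mx; case: eqVneq => [->|_] h1 h2.
  by rewrite (character_linear (rep_chi1 rep)) //
    (character_linear (rep_chi2 rep)) // mx2Z mx2D !mulr0 !addr0.
case: eqVneq h1 h2 => [->|_] h1 h2.
  by rewrite (rep_s_linear rep) // mx2Z mx2D !mulr0 !addr0.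
case: eqVneq h1 h2 => [->|_] h1 h2.
  by rewrite (rep_r_linear rep) // mx2Z mx2D !mulr0 !addr0.
by rewrite scaler0 addr0.
Qed.

(** If both degrees are g, or both g^-1, or a factor has a degree other than 1, g, g^-1, then u v
    lies in [I] and both sides are 0. The other cases are the rules of [matrix_rep]. *)
Lemma rep_mxM h k u v : homogeneous h u -> homogeneous k v ->
  rep_mx (h * k)%g (u * v) = rep_mx h u * rep_mx k v.
Proof.
move=> hu kv; have huv := homogeneousM hu kv.
have null : I (u * v) -> rep_mx h u * rep_mx k v = 0 ->
    rep_mx (h * k)%g (u * v) = rep_mx h u * rep_mx k v.
  by move=> Iuv ->; apply: rep_mx_vanishes.
have nullu : I u -> rep_mx (h * k)%g (u * v) = rep_mx h u * rep_mx k v.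
  move=> Iu; apply: null; last by rewrite rep_mx_vanishes ?mul0r.
  by case: idealI => _ _; apply.
have nullv : I v -> rep_mx (h * k)%g (u * v) = rep_mx h u * rep_mx k v.
  move=> Iv; apply: null; last by rewrite [rep_mx k v]rep_mx_vanishes ?mulr0.
  by case: idealI => _ + _; apply.
have four l w : homogeneous l w -> [\/ l = 1%g, l = g, l = g^-1%g | I w].
  move=> lw; have [->|l1] := eqVneq l 1%g; first by constructor 1.
  have [->|lg] := eqVneq l g; first by constructor 2.
  have [->|lgV] := eqVneq l g^-1%g; first by constructor 3.
  by constructor 4; exact: (other_degree l1 lg lgV lw).
have zero := (mulr0, mul0r, addr0, add0r).
case: (four h u hu) => [h1|hg|hgV|Iu]; last exact: nullu;
case: (four k v kv) => [k1|kg|kgV|Iv]; try exact: nullv; subst h k.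
- rewrite mulg1 !rep_mx1 mx2M !zero.
  by rewrite (characterM (rep_chi1 rep)) // (characterM (rep_chi2 rep)).
- by rewrite mul1g rep_mx1 !rep_mxg mx2M !zero (rep_sMl rep).
- by rewrite mul1g rep_mx1 !rep_mxgV mx2M !zero (rep_rMl rep).
- by rewrite mulg1 rep_mx1 !rep_mxg mx2M !zero (rep_sMr rep).
- by apply: null; [apply: product_degree_g | rewrite !rep_mxg mx2M !zero
  -mx2_0].
- by rewrite mulgV rep_mx1 rep_mxg rep_mxgV mx2M !zero (rep_zw rep) //
  (rep_zw0 rep).
- by rewrite mulg1 rep_mx1 !rep_mxgV mx2M !zero (rep_rMr rep).
- by rewrite mulVg rep_mx1 rep_mxg rep_mxgV mx2M !zero (rep_wz rep) //
  (rep_wz0 rep).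
- by apply: null; [apply: product_degree_gV | rewrite !rep_mxgV mx2M !zero
  -mx2_0].
Qed.

(** A homomorphism is determined by its values on the variables, so the representation is one of the
    graded evaluations at which identities vanish. *)
Lemma free_eval_rep h p : homogeneous h p ->
  free_eval (fun i k => rep_mx k (xvar F i k)) p = rep_mx h p.
Proof.
move=> hp; set a := fun i k => _.
have wordE t : free_eval a (word F t) = rep_mx (seq_deg t) (word F t).
  rewrite free_eval_word; elim: t => [|v t IH].
    by rewrite /word /seq_deg !big_nil rep_mx1 (character1 (rep_chi1 rep))
      (character1 (rep_chi2 rep)) -mx2_1.
  rewrite /word /seq_deg !big_cons -/(word F t) -/(seq_deg t) IH.
  rewrite rep_mxM //; [exact: homogeneous_xvar | exact: homogeneous_word].
suff [] : homogeneous h p /\ free_eval a p = rep_mx h p by [].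
move: p hp; apply: homogeneous_ind.
  have [h0 hlin] := homogeneous_subspace F h; split.
    by split=> //; rewrite free_eval0 rep_mx_vanishes //; apply: subI.1.
  move=> c u v [hu eu] [hv ev]; split; first exact: hlin.
  by rewrite free_eval_linear rep_mx_linear // eu ev.
by move=> t th; rewrite wordE th -th; split=> //; apply: homogeneous_word.
Qed.

End RepresentationEvaluation.

(** The condition of [graded_identity] on values alone; a constant term is allowed, as in
    [homogeneous]. *)
Definition evaluates_to0 (p : freealg F G) : Prop :=
  forall a : nat -> G -> 'M[F]_2, (forall i h, a i h \in @M2_comp F G g h) ->
  free_eval a p = 0.

Lemma evaluates_to0_rep h p chi1 chi2 s r : homogeneous h p -> evaluates_to0 p
  ->
  matrix_rep I E Z W chi1 chi2 s r -> rep_mx chi1 chi2 s r h p = 0.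
Proof.
move=> hp p0 rep; rewrite -(free_eval_rep rep hp); apply: p0 => i k.
exact: rep_mx_comp.
Qed.

Lemma identity_degree_g p : Z p -> evaluates_to0 p -> I p.
Proof.
move=> Zp p0; apply: boolp.contrapT => nIp.
have [chi1 [chi2 [s [r [rep sp]]]]] := off_diagonal_rep idealI
  homogeneous1_subalgebra homogeneous1_power (homogeneous_subbimodule g)
  (homogeneous_subbimodule g^-1%g) product_g_gV product_gV_g product_degree_g
    Zp nIp.
have := evaluates_to0_rep Zp p0 rep.
rewrite rep_mxg sp => /matrixP/(_ 0 1); rewrite mx2E mxE => /eqP.
by rewrite oner_eq0.
Qed.

Lemma identity_degree_gV p : W p -> evaluates_to0 p -> I p.
Proof.
move=> Wp p0; apply: boolp.contrapT => nIp.
have [chi1 [chi2 [s [r [rep sp]]]]] := off_diagonal_rep idealI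
  homogeneous1_subalgebra homogeneous1_power (homogeneous_subbimodule g^-1%g)
  (homogeneous_subbimodule g) (fun w z Ww Zz => product_gV_g Zz Ww)
  (fun w z Ww Zz => product_g_gV Zz Ww) product_degree_gV Wp nIp.
(* The representation was built with Z and W exchanged, so it is flipped to respect the grading. *)
have := evaluates_to0_rep Wp p0 (matrix_rep_flip rep).
rewrite rep_mxgV sp => /matrixP/(_ 1 0); rewrite mx2E mxE => /eqP.
by rewrite oner_eq0.
Qed.

Lemma identity_degree1 p : E p -> evaluates_to0 p -> I p.
Proof.
move=> Ep p0; apply: boolp.contrapT => nIp.
have [_ Zl Zr] := homogeneous_subbimodule g.
(* p z is again an identity, now of degree g, so the case of degree g applies. *)
have pZ z : Z z -> I (p * z).
  move=> Zz; apply: identity_degree_g; first exact: Zl.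
  by move=> a aP; rewrite free_evalM p0 // mul0r.
have Zp z : Z z -> I (z * p).
  move=> Zz; apply: identity_degree_g; first exact: Zr.
  by move=> a aP; rewrite free_evalM p0 // mulr0.
have [chi [rep chip]] := diagonal_rep idealI homogeneous1_subalgebra
  homogeneous1_power product_g_gV product_gV_g Ep nIp pZ Zp.
have := evaluates_to0_rep Ep p0 rep.
rewrite rep_mx1 => /matrixP/(_ 0 0); rewrite mx2E mxE => /eqP.
by rewrite (negbTE chip).
Qed.

(** The parts of degree 1, g and g^-1 take values in different matrix entries, so each is an
    identity by itself; words of any other degree lie in [I] by the generators x_{1,h}. *)
Lemma evaluates_to0_I p : evaluates_to0 p -> I p.
Proof.
move=> p0.
pose other := predD (predD (predC (pred1 1%g)) (pred1 g)) (pred1 g^-1%g).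
have pE : p = part (pred1 1%g) p + (part (pred1 g) p +
    (part (pred1 g^-1%g) p + part other p)).
  rewrite {1}(part_split (pred1 1%g) p); congr (_ + _).
  rewrite (part_split_sub (P := predC _) (Q := pred1 g));
    last by move=> h /eqP->.
  congr (_ + _); apply: part_split_sub => h /eqP->.
  by rewrite /= gVg gV1.
have otherE h : other h -> [/\ h != 1%g, h != g & h != g^-1%g].
  by rewrite /other /= => /and3P[-> -> ->].
have hpart h := @homogeneous_part F G h p.
have M2_1 : 1 \in @M2_comp F G g 1%g by rewrite mx2_1 M2_comp_unit.
have evalpart (a : nat -> G -> 'M[F]_2) h :
    (forall i k, a i k \in @M2_comp F G g k) ->
    free_eval a (part (pred1 h) p) \in @M2_comp F G g h.
  move=> aP; exact: (free_eval_graded (Agr := fun k A => A \in @M2_comp F G g k)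
    (M2_comp_subspace F g) M2_1 (M2_compM gVg) aP (hpart h)).
have evalother (a : nat -> G -> 'M[F]_2) :
    (forall i k, a i k \in @M2_comp F G g k) -> free_eval a (part other p) = 0.
  move=> aP; apply: (part_subspace (U := fun u => free_eval a u = 0)).
    apply: (subspace_free_eval a (U := fun A => A = 0)).
    by split=> // c A B -> ->; rewrite scaler0 addr0.
  move=> t /otherE[t1 tg tgV].
  have := free_eval_graded (Agr := fun k A => A \in @M2_comp F G g k)
    (M2_comp_subspace F g) M2_1 (M2_compM gVg) aP (@homogeneous_word F G t).
  by rewrite inE (negbTE t1) (negbTE tg) (negbTE tgV) => /eqP.
have parts0 (a : nat -> G -> 'M[F]_2) :
    (forall i k, a i k \in @M2_comp F G g k) ->
    [/\ free_eval a (part (pred1 1%g) p) = 0, free_eval a (part (pred1 g) p) = 0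
      & free_eval a (part (pred1 g^-1%g) p) = 0].
  move=> aP; have := p0 a aP; rewrite {1}pE !free_evalD evalother // addr0.
  have [x [y ->]] := M2_comp_1P (evalpart a 1%g aP).
  have [b ->] := M2_comp_gP gVg (evalpart a g aP).
  have [c ->] := M2_comp_gVP gVg (evalpart a g^-1%g aP).
  rewrite !mx2D !(addr0, add0r) => /matrixP e.
  have := (e 0 0, e 0 1, e 1 0, e 1 1); rewrite !mx2E !mxE => -[[[-> ->] ->]
    ->].
  by rewrite -mx2_0.
rewrite pE; apply: (subspaceD subI).
  by apply: identity_degree1 => // a /parts0[].
apply: (subspaceD subI); first by apply: identity_degree_g => // a /parts0[].
apply: (subspaceD subI); first by apply: identity_degree_gV => // a /parts0[].
apply: part_subspace => // t /otherE[t1 tg tgV].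
exact: (other_degree t1 tg tgV (@homogeneous_word _ _ t)).
Qed.
End IdentitiesInIdeal.

Theorem theorem24 (F : finFieldType) (q : nat) (cardF : #|F| = q)
    (G : groupType) (g : G) (cyclicG : cyclic_generator g)
    (cardG : card_gt G 2) :
  forall p : freealg F G,
    graded_identity (@M2_comp F G g) p <->
    TG_generated (@generators F G g q) p.
Proof.
move=> p; subst q; have gVg := cyclic_generator_neq cyclicG cardG.
split=> [[_ p0] I TGI I_gen|]; first exact: (evaluates_to0_I gVg TGI I_gen p0).
(* The graded identities themselves form a T_G-ideal containing the generators. *)
apply; first exact: (M2_identity_TG F gVg).
exact: generators_identity.
Qed.
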